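(* Let $k\to A$ be a unital homomorphism of commutative unital rings, let $(L,\alpha)$ be an arbitrary $A/k$-Lie-Rinehart algebra, let $c\in Z^2(\mathrm{Der}_k(A),A)$ be any 2-cocycle, and let $L_c=L(\alpha^*(c))$ be the $\mathrm D$-Lie algebra associated to $L$ and $c$. There is an exact equivalence of categories $$\psi_c:\mathrm{Conn}(L)\cong\mathrm{Mod}(U^{\otimes}(L_c))$$ preserving injective and projective objects. Consequently, for any two $L$-connections $(V,\nabla)$, $(W,\nabla')$ and any integer $i\ge0$ there are isomorphisms $$\mathrm{Ext}^i((V,\nabla),(W,\nabla'))\cong\mathrm{Ext}^i_{U^{\otimes}(L_c)}(\psi_c(V,\nabla),\psi_c(W,\nabla')),$$ where the left side is the Yoneda Ext-group in the abelian category $\mathrm{Conn}(L)$.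
   Context: An $A/k$-Lie-Rinehart algebra $(L,\alpha)$ is a $k$-Lie algebra and left $A$-module $L$ with a map $\alpha:L\to\mathrm{Der}_k(A)$ of $A$-modules and $k$-Lie algebras such that $[x,uy]=u[x,y]+\alpha(x)(u)y$ for $u\in A$, $x,y\in L$. A 2-cocycle $c\in Z^2(\mathrm{Der}_k(A),A)$ is an alternating $A$-bilinear map with $x(c(y,z))-y(c(x,z))+z(c(x,y))-c([x,y],z)+c([x,z],y)-c([y,z],x)=0$. $\mathrm{Conn}(L)$: objects are pairs $(E,\nabla)$ with $E$ a left $A$-module and $\nabla:L\to\mathrm{End}_k(E)$ an $A$-linear map with $\nabla(x)(ae)=a\nabla(x)(e)+\alpha(x)(a)e$ for all $x\in L,a\in A,e\in E$; no flatness is assumed. Morphisms are $A$-linear maps commuting with the action of $L$. $L_c=L(\alpha^*(c))=Az\oplus L$ (with $Az$ free on $z$) has left action $b(az+x)=(ba)z+bx$, right action $(az+x)b=(ab+\alpha(x)(b))z+bx$, bracket $[az+x,bz+y]=(\alpha(x)(b)-\alpha(y)(a)+c(\alpha(x),\alpha(y)))z+[x,y]$ and central element $z$. $U^{\otimes}(L_c)=T^*_k(L_c)/J_1$, where $T^*_k(L_c)$ is the tensor algebra over $k$ and $J_1$ is the 2-sided ideal generated by $z-1$, $au-(az)\otimes u$, $vb-v\otimes(bz)$ for all $a,b\in A$, $u,v\in L_c$. $\mathrm{Mod}(R)$ is the category of left $R$-modules. *)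

(* Defs.v *)
From HB Require Import structures.
From mathcomp Require Import all_boot all_algebra.
From mathcomp Require Import ring.
From mathcomp Require Import boolp classical_sets functions.
From Stdlib Require Import Relation_Operators.

Set Implicit Arguments.
Unset Strict Implicit.
Unset Printing Implicit Defensive.

Import GRing.Theory.
Local Open Scope ring_scope.
Local Open Scope quotient_scope.

Record addCat := AddCat {
  ob :> Type;
  hom : ob -> ob -> zmodType;
  idm : forall X, hom X X;
  comp : forall X Y Z, hom Y Z -> hom X Y -> hom X Z;
  compA : forall W X Y Z (h : hom Y Z) (g : hom X Y) (f : hom W X),
    comp h (comp g f) = comp (comp h g) f;
  comp1l : forall X Y (f : hom X Y), comp (idm Y) f = f;
  comp1r : forall X Y (f : hom X Y), comp f (idm X) = f;
  compDl : forall X Y Z (g g' : hom Y Z) (f : hom X Y),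
    comp (g + g') f = comp g f + comp g' f;
  compDr : forall X Y Z (g : hom Y Z) (f f' : hom X Y),
    comp g (f + f') = comp g f + comp g f';
  zob : ob;
  idm_zob : idm zob = 0;
  dsum : ob -> ob -> ob;
  in1 : forall X Y, hom X (dsum X Y);
  in2 : forall X Y, hom Y (dsum X Y);
  pr1 : forall X Y, hom (dsum X Y) X;
  pr2 : forall X Y, hom (dsum X Y) Y;
  pr1_in1 : forall X Y, comp (pr1 X Y) (in1 X Y) = idm X;
  pr2_in2 : forall X Y, comp (pr2 X Y) (in2 X Y) = idm Y;
  dsum_id : forall X Y,
    comp (in1 X Y) (pr1 X Y) + comp (in2 X Y) (pr2 X Y) = idm (dsum X Y)
}.

Arguments idm {C} X : rename.
Arguments in1 {C} X Y : rename.
Arguments in2 {C} X Y : rename.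
Arguments pr1 {C} X Y : rename.
Arguments pr2 {C} X Y : rename.

Declare Scope cat_scope.
Delimit Scope cat_scope with cat.
Local Open Scope cat_scope.
Notation "g \oc f" := (comp g f) (at level 40, left associativity) : cat_scope.

Section Category.
Variable C : addCat.
Implicit Types X Y Z W : C.

Definition mono X Y (f : hom X Y) :=
  forall W (h h' : hom W X), f \oc h = f \oc h' -> h = h'.

Definition epi X Y (f : hom X Y) :=
  forall W (h h' : hom Y W), h \oc f = h' \oc f -> h = h'.

Definition is_kernel K Y Z (g : hom Y Z) (i : hom K Y) :=
  g \oc i = 0 /\
  forall W (h : hom W Y), g \oc h = 0 -> exists! l : hom W K, h = i \oc l.

(* Exactness of X --f--> Y --g--> Z: f is an epimorphism onto the kernel of g. *)
Definition exact_at X Y Z (f : hom X Y) (g : hom Y Z) :=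
  exists K (i : hom K Y) (e : hom X K),
    [/\ is_kernel g i, f = i \oc e & epi e].

Definition short_exact X Y Z (f : hom X Y) (g : hom Y Z) :=
  [/\ mono f, exact_at f g & epi g].

Definition projective X :=
  forall Y Z (e : hom Y Z), epi e ->
  forall f : hom X Z, exists g : hom X Y, f = e \oc g.

Definition injective_ob X :=
  forall Y Z (m : hom Y Z), mono m ->
  forall f : hom Y X, exists g : hom Z X, f = g \oc m.

Definition dsum_map X Y X' Y' (f : hom X X') (g : hom Y Y') :
    hom (dsum X Y) (dsum X' Y') :=
  in1 X' Y' \oc f \oc pr1 X Y + in2 X' Y' \oc g \oc pr2 X Y.
Definition diagm X : hom X (dsum X X) := in1 X X + in2 X X.
Definition codiagm X : hom (dsum X X) X := pr1 X X + pr2 X X.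

End Category.

Record functor (C D : addCat) := Functor {
  fob :> C -> D;
  fmap : forall X Y : C, hom X Y -> hom (fob X) (fob Y);
  fmap1 : forall X, fmap (idm X) = idm (fob X);
  fmap_comp : forall X Y Z (g : hom Y Z) (f : hom X Y),
    fmap (g \oc f) = fmap g \oc fmap f
}.

Definition nat_iso (C D : addCat) (F G : functor C D) :=
  exists (eta : forall X, hom (F X) (G X)) (theta : forall X, hom (G X) (F X)),
  [/\ forall X, theta X \oc eta X = idm (F X),
      forall X, eta X \oc theta X = idm (G X) &
      forall X Y (f : hom X Y), eta Y \oc fmap F f = fmap G f \oc eta X].

Definition id_functor (C : addCat) : functor C C :=
  @Functor C C id (fun X Y f => f) (fun X => erefl) (fun X Y Z g f => erefl).

Program Definition comp_functor (C D E : addCat)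
    (G : functor D E) (F : functor C D) : functor C E :=
  @Functor C E (fun X => G (F X)) (fun X Y f => fmap G (fmap F f)) _ _.
Next Obligation. by move=> *; rewrite !fmap1. Qed.
Next Obligation. by move=> *; rewrite !fmap_comp. Qed.

Definition is_equivalence (C D : addCat) (F : functor C D) :=
  exists G : functor D C,
    nat_iso (comp_functor G F) (id_functor C) /\
    nat_iso (comp_functor F G) (id_functor D).

Definition is_exact (C D : addCat) (F : functor C D) :=
  (forall (X Y : C) (f g : hom X Y), fmap F (f + g) = fmap F f + fmap F g) /\
  (forall (X Y Z : C) (f : hom X Y) (g : hom Y Z),
     short_exact f g -> short_exact (fmap F f) (fmap F g)).

Section Yoneda.
Variable C : addCat.
Implicit Types A B X Y : C.

(* A term of [lseq B n X] is a sequence B --> E_n --> ... --> E_1 --> X. *)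
Fixpoint lseq B (n : nat) X : Type :=
  if n is m.+1 then {E : C & (hom E X * lseq B m E)%type} else hom B X.

(* Exactness of 0 --> B --> E_n --> ... --> E_1 --> X --g--> Y, away from Y. *)
Fixpoint lexact B n X Y (g : hom X Y) : lseq B n X -> Prop :=
  match n return lseq B n X -> Prop with
  | 0 => fun s => mono s /\ exact_at s g
  | m.+1 => fun s =>
      exact_at (projT2 s).1 g /\ lexact (projT2 s).1 (projT2 s).2
  end.

(* Exactness of 0 --> B --> E_n --> ... --> E_0 --> A --> 0. *)
Definition is_ext B n A (s : lseq B n.+1 A) :=
  epi (projT2 s).1 /\ lexact (projT2 s).1 (projT2 s).2.

(* Morphisms of sequences with prescribed maps [b] and [u] on the two ends. *)
Fixpoint lmor B B' (b : hom B B') n X X' (u : hom X X') :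
    lseq B n X -> lseq B' n X' -> Prop :=
  match n return lseq B n X -> lseq B' n X' -> Prop with
  | 0 => fun s s' => u \oc s = s' \oc b
  | m.+1 => fun s s' => exists v : hom (projT1 s) (projT1 s'),
      u \oc (projT2 s).1 = (projT2 s').1 \oc v /\
      lmor b v (projT2 s).2 (projT2 s').2
  end.

Fixpoint lsum B B' n X X' :
    lseq B n X -> lseq B' n X' -> lseq (dsum B B') n (dsum X X') :=
  match n return lseq B n X -> lseq B' n X' ->
                 lseq (dsum B B') n (dsum X X') with
  | 0 => fun s s' => dsum_map s s'
  | m.+1 => fun s s' =>
      existT _ (dsum (projT1 s) (projT1 s'))
        (dsum_map (projT2 s).1 (projT2 s').1,
         lsum (projT2 s).2 (projT2 s').2)
  end.

Definition ext_step B n A (s t : lseq B n.+1 A) :=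
  [/\ is_ext s, is_ext t & lmor (idm B) (idm A) s t].

Definition ext_equiv B n A : lseq B n.+1 A -> lseq B n.+1 A -> Prop :=
  clos_refl_sym_trans _ (@ext_step B n A).

(* Ext^i(A, B): equivalence classes of i-fold extensions of A by B, and
   Hom(A, B) for i = 0. *)
Definition yext (i : nat) A B : Type :=
  if i is n.+1 then
    {c : lseq B n.+1 A -> Prop |
      exists s, is_ext s /\ (forall t, c t <-> ext_equiv s t)}
  else hom A B.

(* [s3] is a Baer sum of [s1] and [s2]: it is codiagm . (s1 (+) s2) . diagm,
   i.e. [e] is a pull-back of the direct sum along the diagonal of A, and [s3] a
   push-out of [e] along the codiagonal of B.  A morphism of extensions s --> t
   with end maps (id, u) exhibits s as a pull-back of t along u, and one with
   end maps (u, id) exhibits t as a push-out of s along u: literally for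
   one-fold extensions (by the five lemma), and up to Yoneda equivalence in
   general. *)
Definition baer_sum B n A (s1 s2 s3 : lseq B n.+1 A) :=
  exists e : lseq (dsum B B) n.+1 A,
    [/\ is_ext e, lmor (idm (dsum B B)) (diagm A) e (lsum s1 s2) &
        lmor (codiagm B) (idm A) e s3].

Definition yext_add (i : nat) A B : yext i A B -> yext i A B -> yext i A B -> Prop :=
  match i return yext i A B -> yext i A B -> yext i A B -> Prop with
  | 0 => fun f1 f2 f3 => f3 = f1 + f2
  | n.+1 => fun c1 c2 c3 => exists s1 s2 s3,
      [/\ proj1_sig c1 s1, proj1_sig c2 s2, proj1_sig c3 s3 & baer_sum s1 s2 s3]
  end.

(* An isomorphism of groups from Ext^i(A, B), with the Baer sum, onto G.  With
   "<->", it also expresses that any two classes have a Baer sum, lying in a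
   single class. *)
Definition yext_iso (i : nat) A B (G : zmodType) :=
  exists h : yext i A B -> G, bijective h /\
    forall x y z, yext_add x y z <-> h z = h x + h y.

End Yoneda.

Record proj_res (C : addCat) (M : C) := ProjRes {
  pob : nat -> C;
  pdiff : forall i, hom (pob i.+1) (pob i);
  paug : hom (pob 0) M;
  pob_projective : forall i, projective (pob i);
  paug_epi : epi paug;
  paug_exact : exact_at (pdiff 0) paug;
  pdiff_exact : forall i, exact_at (pdiff i.+1) (pdiff i)
}.

Section Derived.
Variables (C : addCat) (M N : C) (P : proj_res M).

Definition cocycle_pred i : {pred hom (pob P i) N} :=
  [pred f | f \oc pdiff P i == 0].

Lemma cocycle_zmod_closed i : zmod_closed (@cocycle_pred i).
Proof.
have c0 X Y Z (f : hom X Y) : (0 : hom Y Z) \oc f = 0.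
  by apply: (addrI (0 \oc f)); rewrite -compDl !addr0.
split=> [|f g]; rewrite !inE ?c0 // => /eqP f0 /eqP g0.
apply/eqP/(addIr (g \oc pdiff P i)).
by rewrite -compDl subrK f0 add0r g0.
Qed.
HB.instance Definition _ i :=
  GRing.isZmodClosed.Build (hom (pob P i) N) (@cocycle_pred i) (@cocycle_zmod_closed i).

Definition cocycle i := {f : hom (pob P i) N | f \in @cocycle_pred i}.
HB.instance Definition _ i :=
  SubChoice.copy (cocycle i) {f : hom (pob P i) N | f \in @cocycle_pred i}.
HB.instance Definition _ i := [SubChoice_isSubZmodule of cocycle i by <:].

Definition is_cobound i : hom (pob P i) N -> Prop :=
  match i with
  | 0 => fun f => f = 0
  | j.+1 => fun f => exists g : hom (pob P j) N, f = g \oc pdiff P j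
  end.

Definition cobound_pred i : {pred cocycle i} :=
  [pred f | `[< is_cobound (val f) >]].

Lemma cobound_predP i (f : cocycle i) :
  reflect (is_cobound (val f)) (f \in @cobound_pred i).
Proof. exact: asboolP. Qed.

Lemma cobound_zmod_closed i : zmod_closed (@cobound_pred i).
Proof.
case: i => [|i]; split=> [|f g].
- exact/cobound_predP.
- move=> /cobound_predP/= f0 /cobound_predP/= g0.
  by apply/cobound_predP; rewrite /= f0 g0 subr0.
- apply/cobound_predP; exists 0.
  by apply: (addrI (0 \oc pdiff P i)); rewrite -compDl !addr0.
- move=> /cobound_predP[f' ff'] /cobound_predP[g' gg'].
  apply/cobound_predP; exists (f' - g').
  by apply: (addIr (g' \oc pdiff P i)); rewrite -compDl subrK -gg' /= subrK.
Qed.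
HB.instance Definition _ i :=
  GRing.isZmodClosed.Build (cocycle i) (@cobound_pred i)
    (@cobound_zmod_closed i).

Definition homology i : zmodType := Quotient.quot (@cobound_pred i).

End Derived.

Lemma proj_res_exists (C : addCat)
    (ker : forall (Y Z : C) (g : hom Y Z),
      exists K (i : hom K Y), is_kernel g i)
    (enough : forall X : C, exists P (e : hom P X), projective P /\ epi e)
    (M : C) : inhabited (proj_res M).
Proof.
have cov (X Y : C) (g : hom X Y) :
    {P & {d : hom P X | projective P /\ exact_at d g}}.
  have [K /cid[i Ki]] := cid (ker _ _ g).
  have [P /cid[e [Pp Pe]]] := cid (enough K).
  by exists P, (i \oc e); split=> //; exists K, i, e.
have [P0 /cid[e0 [P0p P0e]]] := cid (enough M).
pose T := {X : C & {Y : C & hom X Y}}.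
pose step (t : T) : T :=
  let c := cov _ _ (projT2 (projT2 t)) in
  existT _ (projT1 c) (existT _ (projT1 t) (proj1_sig (projT2 c))).
pose S n := iter n step (existT _ P0 (existT _ M e0)).
constructor.
exists (fun n => projT1 (S n)) (fun n => projT2 (projT2 (S n.+1))) e0 => //.
- case=> [//|n] /=; exact: (proj2_sig (projT2 (cov _ _ _))).1.
- exact: (proj2_sig (projT2 (cov _ _ e0))).2.
- move=> n; exact: (proj2_sig (projT2 (cov _ _ (projT2 (projT2 (S n.+1)))))).2.
Qed.

Section Modules.
Variable R : pzRingType.
Implicit Types M N P : lmodType R.

Definition lhom_pred M N : {pred M -> N} := [pred f | `[< linear f >]].
Arguments lhom_pred : clear implicits.

Lemma lhom_predP M N (f : M -> N) : reflect (linear f) (f \in lhom_pred M N).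
Proof. exact: asboolP. Qed.

Lemma lhom_zmod_closed M N : zmod_closed (lhom_pred M N).
Proof.
split=> [|f g /lhom_predP lf /lhom_predP lg]; apply/lhom_predP => a x y /=.
  by rewrite scaler0 addr0.
by rewrite !fctE lf lg scalerBr opprD addrACA.
Qed.
HB.instance Definition _ M N :=
  GRing.isZmodClosed.Build (M -> N) (lhom_pred M N) (lhom_zmod_closed M N).

Definition lhom M N := {f : M -> N | f \in lhom_pred M N}.
HB.instance Definition _ M N := SubChoice.copy (lhom M N) {f : M -> N | f \in lhom_pred M N}.
HB.instance Definition _ M N := [SubChoice_isSubZmodule of lhom M N by <:].

Lemma lhomP M N (f : lhom M N) : linear (val f).
Proof. exact/lhom_predP/valP. Qed.

Lemma lhom0 M N (f : lhom M N) : val f 0 = 0.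
Proof. by rewrite -[0](addNr 0) -scaleN1r lhomP scaleN1r addNr. Qed.

Lemma lhom_eq M N (f g : lhom M N) : val f =1 val g -> f = g.
Proof. by move=> fg; apply/val_inj/funext. Qed.

Definition mk_lhom M N (f : M -> N) (lf : linear f) : lhom M N :=
  exist _ f (introT (lhom_predP f) lf).

Lemma lcomp_subproof M N P (g : lhom N P) (f : lhom M N) :
  linear (val g \o val f).
Proof. by move=> a x y /=; rewrite !lhomP. Qed.

Lemma linear_in1 M N : linear (fun x : M => (x, 0 : N)).
Proof. by move=> a x y; congr pair; rewrite /= scaler0 addr0. Qed.

Lemma linear_in2 M N : linear (fun y : N => (0 : M, y)).
Proof. by move=> a x y; congr pair; rewrite /= scaler0 addr0. Qed.

Definition Mod : addCat.
Proof.
unshelve refine (@AddCat (lmodType R) lhom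
  (fun M => @mk_lhom M M id (fun a x y => erefl))
  (fun M N P g f => mk_lhom (lcomp_subproof g f))
  _ _ _ _ _ ('rV[R]_0 : lmodType R) _
  (fun M N => (M * N)%type : lmodType R)
  (fun M N => mk_lhom (@linear_in1 M N))
  (fun M N => mk_lhom (@linear_in2 M N))
  (fun M N => @mk_lhom (M * N)%type M fst (fun a x y => erefl))
  (fun M N => @mk_lhom (M * N)%type N snd (fun a x y => erefl)) _ _ _).
- by move=> *; apply: lhom_eq.
- by move=> *; apply: lhom_eq.
- by move=> *; apply: lhom_eq.
- by move=> *; apply: lhom_eq.
- move=> M N P g f f'; apply: lhom_eq => x /=.
  by have := lhomP g 1 (val f x) (val f' x); rewrite !scale1r.
- by apply: lhom_eq => x; apply/rowP => -[].
- by move=> *; apply: lhom_eq.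
- by move=> *; apply: lhom_eq.
- move=> M N; apply: lhom_eq => -[x y].
  by congr pair; rewrite /= ?addr0 ?add0r.
Defined.

End Modules.

Section EnoughProjectives.
Variable R : pzRingType.
Implicit Types M N : lmodType R.

Section Cokernel.
Variables (M N : lmodType R) (f : lhom M N).

Definition im_pred : {pred N} := [pred y | `[< exists x, val f x = y >]].

Lemma im_predP y : reflect (exists x, val f x = y) (y \in im_pred).
Proof. exact: asboolP. Qed.

Lemma im_zmod_closed : zmod_closed im_pred.
Proof.
split=> [|_ _ /im_predP[x <-] /im_predP[y <-]]; apply/im_predP.
  by exists 0; exact: lhom0.
by exists (- y + x); have := lhomP f (-1) y x; rewrite !scaleN1r addrC => ->.
Qed.
HB.instance Definition _ := GRing.isZmodClosed.Build N im_pred im_zmod_closed.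

Definition coker : Type := Quotient.quot im_pred.
HB.instance Definition _ := GRing.Zmodule.on coker.

Definition coker_pi (y : N) : coker := \pi_(Quotient.quot im_pred) y.

Lemma coker_pi_eq y y' : y - y' \in im_pred -> coker_pi y = coker_pi y'.
Proof. by move=> ?; apply/eqP; rewrite /coker_pi -Quotient.idealrBE. Qed.

Lemma coker_piD y y' : coker_pi (y + y') = coker_pi y + coker_pi y'.
Proof. exact: raddfD. Qed.

Lemma coker_repr (q : coker) : coker_pi (repr q) = q.
Proof. exact: reprK. Qed.

Definition coker_scale (a : R) (q : coker) : coker := coker_pi (a *: repr q).

Lemma coker_scaleE a y : coker_scale a (coker_pi y) = coker_pi (a *: y).
Proof.
apply: coker_pi_eq; rewrite -scalerBr.
have : repr (coker_pi y) - y \in im_pred by rewrite Quotient.idealrBE reprK.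
move=> /im_predP[x fx]; apply/im_predP; exists (a *: x).
by rewrite -fx -[a *: x]addr0 lhomP lhom0 addr0.
Qed.

Lemma coker_scaleA a b q :
  coker_scale a (coker_scale b q) = coker_scale (a * b) q.
Proof. by rewrite -[q]coker_repr !coker_scaleE scalerA. Qed.
Lemma coker_scale1 : left_id 1 coker_scale.
Proof. by move=> q; rewrite -[q]coker_repr coker_scaleE scale1r. Qed.
Lemma coker_scaleDr : right_distributive coker_scale +%R.
Proof.
move=> a q q'; rewrite -[q]coker_repr -[q']coker_repr.
by rewrite -coker_piD !coker_scaleE scalerDr coker_piD.
Qed.
Lemma coker_scaleDl q : {morph coker_scale^~ q : a b / a + b}.
Proof.
move=> a b; rewrite -[q]coker_repr.
by rewrite !coker_scaleE scalerDl coker_piD.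
Qed.
HB.instance Definition _ := GRing.Zmodule_isLmodule.Build R coker
  coker_scaleA coker_scale1 coker_scaleDr coker_scaleDl.

Lemma coker_pi_linear : linear coker_pi.
Proof. by move=> a x y; rewrite coker_piD -coker_scaleE. Qed.

End Cokernel.

Lemma epi_surj (M N : Mod R) (f : hom M N) :
  epi f <-> forall y, exists x, val f x = y.
Proof.
split=> [fepi y|fsurj P g h gh]; last first.
  apply: lhom_eq => y; have [x <-] := fsurj y.
  exact: (congr1 (fun k : lhom M P => val k x) gh).
pose p : hom N (coker f : Mod R) := mk_lhom (coker_pi_linear f).
have /(congr1 (fun k : lhom _ _ => val k y))/= : p = 0.
  apply: fepi; apply: lhom_eq => x /=.
  rewrite -[RHS](raddf0 (\pi_(Quotient.quot (im_pred f)))).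
  by apply: coker_pi_eq; rewrite subr0; apply/im_predP; exists x.
move/eqP; rewrite -[X in _ == X](raddf0 (\pi_(Quotient.quot (im_pred f)))).
by rewrite -Quotient.idealrBE subr0 => /im_predP.
Qed.

Section Kernel.
Variables (M N : lmodType R) (f : lhom M N).

Definition ker_pred : {pred M} := [pred x | val f x == 0].

Lemma ker_predP x : reflect (val f x = 0) (x \in ker_pred).
Proof. exact: eqP. Qed.

Lemma ker_submod_closed : submod_closed ker_pred.
Proof.
split=> [|a x y]; first exact/ker_predP/lhom0.
move=> /ker_predP fx /ker_predP fy; apply/ker_predP.
by rewrite lhomP fx fy scaler0 addr0.
Qed.
HB.instance Definition _ := GRing.isSubmodClosed.Build R M ker_pred
  ker_submod_closed.

Definition kern := {x : M | x \in ker_pred}.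
HB.instance Definition _ := SubChoice.copy kern {x : M | x \in ker_pred}.
HB.instance Definition _ := [SubChoice_isSubLmodule of kern by <:].

End Kernel.

Lemma Mod_kernel (M N : Mod R) (f : hom M N) :
  exists K (i : hom K M), is_kernel f i.
Proof.
have lin : linear (val : kern f -> M) by move=> a x y; rewrite linearP.
exists (kern f : lmodType R), (mk_lhom lin); split.
  by apply: lhom_eq => x; apply/ker_predP/(valP x).
move=> W h /(congr1 (fun k : lhom W N => val k)) fh.
have hK w : val h w \in ker_pred f by rewrite inE; apply/eqP/(congr1 (@^~ w) fh).
have lh : linear (fun w => exist _ (val h w) (hK w) : kern f).
  by move=> a x y; apply: val_inj; rewrite linearP /= lhomP.
exists (mk_lhom lh); split=> [|l hl]; first exact: lhom_eq.
apply: lhom_eq => w; apply: val_inj.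
exact: (congr1 (fun k : lhom W M => val k w) hl).
Qed.

(* The free module on a set X, as formal sums modulo the identities that hold
   after every map from X to a module. *)
Section Free.
Variable X : Type.

Definition fsum := {classic seq (R * X)}.
Definition fsum_ev (N : lmodType R) (g : X -> N) (s : fsum) : N :=
  \sum_(p <- (s : seq (R * X))) p.1 *: g p.2.
Definition fsum_eq (s t : fsum) : bool :=
  `[< forall (N : lmodType R) (g : X -> N), fsum_ev g s = fsum_ev g t >].

Lemma fsum_equiv : equiv_class_of fsum_eq.
Proof.
split=> [s|s t|t s u]; first exact/asboolP.
  by apply/asboolP/asboolP => st N g; rewrite st.
by move=> /asboolP st /asboolP tu; apply/asboolP => N g; rewrite st tu.
Qed.
Canonical fsum_equiv_rel := EquivRelPack fsum_equiv.

Definition free : Type := {eq_quot fsum_eq}.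
HB.instance Definition _ := Choice.on free.

Definition free_pi (s : fsum) : free := \pi_({eq_quot fsum_eq}) s.
Definition free_lift (N : lmodType R) (g : X -> N) (u : free) : N :=
  fsum_ev g (repr (u : {eq_quot fsum_eq})).

Lemma free_piE (N : lmodType R) (g : X -> N) s :
  free_lift g (free_pi s) = fsum_ev g s.
Proof.
rewrite /free_lift /free_pi; case: piP => t /eqmodP/= st.
by move/asboolP: (st) => ->.
Qed.

Lemma free_eq (u v : free) :
  (forall (N : lmodType R) (g : X -> N), free_lift g u = free_lift g v) ->
  u = v.
Proof.
by move=> uv; rewrite -[u]reprK -[v]reprK; apply/eqmodP/asboolP.
Qed.

Definition free0 : free := free_pi [::].
Definition free_add (u v : free) : free :=
  free_pi ((repr u : seq (R * X)) ++ (repr v : seq (R * X))).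
Definition free_scale (a : R) (u : free) : free :=
  free_pi [seq (a * p.1, p.2) | p <- (repr u : seq (R * X))].

Lemma free_lift0 N (g : X -> N) : free_lift g free0 = 0.
Proof. by rewrite free_piE /fsum_ev big_nil. Qed.
Lemma free_liftD N (g : X -> N) u v :
  free_lift g (free_add u v) = free_lift g u + free_lift g v.
Proof. by rewrite free_piE /fsum_ev big_cat. Qed.
Lemma free_liftZ N (g : X -> N) a u :
  free_lift g (free_scale a u) = a *: free_lift g u.
Proof.
rewrite free_piE /fsum_ev big_map /free_lift /fsum_ev scaler_sumr.
by apply: eq_bigr => p _; rewrite scalerA.
Qed.
Let liftE := (free_lift0, free_liftD, free_liftZ).

Lemma free_addA : associative free_add.
Proof. by move=> u v w; apply: free_eq => N g; rewrite !liftE addrA. Qed.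
Lemma free_addC : commutative free_add.
Proof. by move=> u v; apply: free_eq => N g; rewrite !liftE addrC. Qed.
Lemma free_add0 : left_id free0 free_add.
Proof. by move=> u; apply: free_eq => N g; rewrite !liftE add0r. Qed.
Lemma free_addN : left_inverse free0 (free_scale (-1)) free_add.
Proof. by move=> u; apply: free_eq => N g; rewrite !liftE scaleN1r addNr. Qed.
HB.instance Definition _ := GRing.isZmodule.Build free
  free_addA free_addC free_add0 free_addN.

Lemma free_scaleA a b u : free_scale a (free_scale b u) = free_scale (a * b) u.
Proof. by apply: free_eq => N g; rewrite !liftE scalerA. Qed.
Lemma free_scale1 : left_id 1 free_scale.
Proof. by move=> u; apply: free_eq => N g; rewrite !liftE scale1r. Qed.
Lemma free_scaleDr : right_distributive free_scale +%R.
Proof. by move=> a u v; apply: free_eq => N g; rewrite !liftE scalerDr. Qed.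
Lemma free_scaleDl u : {morph free_scale^~ u : a b / a + b}.
Proof. by move=> a b; apply: free_eq => N g; rewrite !liftE scalerDl. Qed.
HB.instance Definition _ := GRing.Zmodule_isLmodule.Build R free
  free_scaleA free_scale1 free_scaleDr free_scaleDl.

Definition free_gen (x : X) : free := free_pi [:: (1, x)].

Lemma free_lift_gen N (g : X -> N) x : free_lift g (free_gen x) = g x.
Proof. by rewrite free_piE /fsum_ev big_seq1 scale1r. Qed.

Lemma free_lift_linear N (g : X -> N) : linear (free_lift g).
Proof. by move=> a u v; rewrite [LHS]free_liftD free_liftZ. Qed.

Lemma lhom_free N (f : lhom (free : lmodType R) N) u :
  val f u = free_lift (val f \o free_gen) u.
Proof.
rewrite -[u]reprK; elim: (repr u : seq (R * X)) => [|p s IHs].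
  by rewrite [RHS]free_piE /fsum_ev big_nil; exact: lhom0.
have E : free_pi (p :: s) = p.1 *: free_gen p.2 + free_pi s.
  apply: free_eq => N' g; rewrite free_liftD free_liftZ free_lift_gen.
  by rewrite !free_piE /fsum_ev big_cons.
rewrite -[\pi _]/(free_pi (p :: s)) E lhomP free_lift_linear free_lift_gen /=.
by congr (_ + _); exact: IHs.
Qed.

End Free.

Lemma free_projective X : projective ((free X : lmodType R) : Mod R).
Proof.
move=> Y Z e /epi_surj esurj f.
have [g ge] := choice (fun x => esurj (val f (free_gen x))).
exists (mk_lhom (free_lift_linear g)); apply: lhom_eq => u /=.
rewrite (lhom_free f).
have := lhom_free (@comp (Mod R) _ _ _ e (mk_lhom (free_lift_linear g))) u.
move=> /= ->; congr (free_lift _ u); apply: funext => x /=.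
by rewrite free_lift_gen ge.
Qed.

Lemma Mod_enough_projectives (M : Mod R) :
  exists P (e : hom P M), projective P /\ epi e.
Proof.
exists (free M : lmodType R), (mk_lhom (free_lift_linear (fun x : M => x))).
split; first exact: free_projective.
by apply/epi_surj => x; exists (free_gen x); rewrite /= free_lift_gen.
Qed.

End EnoughProjectives.

Definition Mod_proj_res (R : pzRingType) (M : Mod R) : proj_res M :=
  inhabited_witness (proj_res_exists (@Mod_kernel R) (@Mod_enough_projectives R) M).

(* Ext^i_R(M, N), computed from a projective resolution of M. *)
Definition Ext (R : pzRingType) (i : nat) (M N : Mod R) : zmodType :=
  homology N (Mod_proj_res M) i.

Section LieRinehart.
Variables (k A : comPzRingType) (phi : {rmorphism k -> A}).

Definition is_der (d : A -> A^o) :=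
  (forall l a b, d (phi l * a + b) = phi l * d a + d b) /\
  (forall a b, d (a * b) = a * d b + d a * b).

Definition der_pred : {pred A -> A^o} := [pred d | `[< is_der d >]].

Lemma der_predP d : reflect (is_der d) (d \in der_pred).
Proof. exact: asboolP. Qed.

Lemma der_submod_closed : submod_closed der_pred.
Proof.
split=> [|u d e /der_predP[dl dM] /der_predP[el eM]]; apply/der_predP.
  by split=> *; rewrite /= ?mulr0 ?mul0r addr0.
split=> [l a b|a b].
  change (u * d (phi l * a + b) + e (phi l * a + b) =
          phi l * (u * d a + e a) + (u * d b + e b)).
  by rewrite dl el !mulrDr mulrCA -!addrA; congr (_ + _); rewrite addrCA.
change (u * d (a * b) + e (a * b) =
        a * (u * d b + e b) + (u * d a + e a) * b).
by rewrite dM eM; ring.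
Qed.
HB.instance Definition _ :=
  GRing.isSubmodClosed.Build A (A -> A^o) der_pred der_submod_closed.

Definition Der := {d : A -> A^o | d \in der_pred}.
HB.instance Definition _ := SubChoice.copy Der {d : A -> A^o | d \in der_pred}.
HB.instance Definition _ := [SubChoice_isSubLmodule of Der by <:].

Definition der_ev (d : Der) : A -> A := val d.

Lemma derP (d : Der) : is_der (der_ev d).
Proof. exact/der_predP/valP. Qed.

Lemma der_brk_subproof (d e : Der) :
  (fun a => der_ev d (der_ev e a) - der_ev e (der_ev d a)) \in der_pred.
Proof.
have [[dl dM] [el eM]] := (derP d, derP e).
have dD a b : der_ev d (a + b) = der_ev d a + der_ev d b.
  by have := dl 1 a b; rewrite rmorph1 !mul1r.
have eD a b : der_ev e (a + b) = der_ev e a + der_ev e b.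
  by have := el 1 a b; rewrite rmorph1 !mul1r.
apply/der_predP; split=> [l a b|a b].
  by rewrite el dl dl el mulrBr opprD addrACA.
by rewrite dM eM !dD !eD !dM !eM; ring.
Qed.

Definition der_brk (d e : Der) : Der := 
  exist (fun c => c \in der_pred) _ (der_brk_subproof d e).

Record lieRinehart := LieRinehart {
  lrmod :> lmodType A;
  brk : lrmod -> lrmod -> lrmod;
  brk_linl : forall (l : k) (x x' y : lrmod),
    brk (phi l *: x + x') y = phi l *: brk x y + brk x' y;
  brk_linr : forall (l : k) (x y y' : lrmod),
    brk x (phi l *: y + y') = phi l *: brk x y + brk x y';
  brk_alt : forall x, brk x x = 0;
  brk_jacobi : forall x y z,
    brk x (brk y z) + brk y (brk z x) + brk z (brk x y) = 0;
  anchor : {linear lrmod -> Der};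
  anchor_brk : forall x y,
    anchor (brk x y) = der_brk (anchor x) (anchor y);
  brk_leibniz : forall (x : lrmod) (u : A) (y : lrmod),
    brk x (u *: y) = u *: brk x y + der_ev (anchor x) u *: y
}.

Arguments anchor {l} : rename.

Record cocycle2 := Cocycle2 {
  coc :> Der -> Der -> A;
  coc_linl : forall (u : A) (x x' y : Der),
    coc (u *: x + x') y = u * coc x y + coc x' y;
  coc_linr : forall (u : A) (x y y' : Der),
    coc x (u *: y + y') = u * coc x y + coc x y';
  coc_alt : forall x, coc x x = 0;
  coc_closed : forall x y z,
    der_ev x (coc y z) - der_ev y (coc x z) + der_ev z (coc x y)
    - coc (der_brk x y) z + coc (der_brk x z) y - coc (der_brk y z) x = 0
}.

Section Connections.
Variable L : lieRinehart.

Record conn := Connection {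
  cmod :> lmodType A;
  nabla : L -> cmod -> cmod;
  nabla_klin : forall (x : L) (l : k) (e e' : cmod),
    nabla x (phi l *: e + e') = phi l *: nabla x e + nabla x e';
  nabla_lin : forall (u : A) (x x' : L) (e : cmod),
    nabla (u *: x + x') e = u *: nabla x e + nabla x' e;
  nabla_leibniz : forall (x : L) (u : A) (e : cmod),
    nabla x (u *: e) = u *: nabla x e + der_ev (anchor x) u *: e
}.

Definition is_chom (E F : conn) (h : E -> F) :=
  linear h /\ forall x e, h (nabla x e) = nabla x (h e).

Definition chom_pred (E F : conn) : {pred E -> F} :=
  [pred h | `[< is_chom h >]].

Lemma chom_predP (E F : conn) (h : E -> F) :
  reflect (is_chom h) (h \in @chom_pred E F).
Proof. exact: asboolP. Qed.

Lemma nabla0 (E : conn) (x : L) : nabla x (0 : E) = 0.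
Proof.
apply: (addrI (nabla x 0)).
by have := nabla_klin x 1 (0 : E) 0; rewrite rmorph1 !scale1r !addr0 => <-.
Qed.

Lemma nablaB (E : conn) (x : L) (e e' : E) :
  nabla x (e - e') = nabla x e - nabla x e'.
Proof.
apply: (addIr (nabla x e')); rewrite subrK.
by have := nabla_klin x 1 (e - e') e'; rewrite rmorph1 !scale1r subrK.
Qed.

Lemma chom_zmod_closed (E F : conn) : zmod_closed (@chom_pred E F).
Proof.
split=> [|g h /chom_predP[gl gn] /chom_predP[hl hn]]; apply/chom_predP.
  split=> [a x y|x e]; first by rewrite /= scaler0 addr0.
  by rewrite /= nabla0.
split=> [a x y|x e]; rewrite !fctE.
  by rewrite gl hl scalerBr opprD addrACA.
by rewrite gn hn nablaB.
Qed.
HB.instance Definition _ E F :=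
  GRing.isZmodClosed.Build (cmod E -> cmod F) (@chom_pred E F)
    (@chom_zmod_closed E F).

Definition chom (E F : conn) := {h : E -> F | h \in @chom_pred E F}.
HB.instance Definition _ E F :=
  SubChoice.copy (chom E F) {h : cmod E -> cmod F | h \in @chom_pred E F}.
HB.instance Definition _ E F := [SubChoice_isSubZmodule of chom E F by <:].

Lemma chomP (E F : conn) (h : chom E F) : is_chom (val h).
Proof. exact/chom_predP/valP. Qed.

Lemma chom_eq (E F : conn) (g h : chom E F) : val g =1 val h -> g = h.
Proof. by move=> gh; apply/val_inj/funext. Qed.

Definition mk_chom (E F : conn) (h : E -> F) (hh : is_chom h) : chom E F :=
  exist _ h (introT (chom_predP h) hh).

Lemma chom_id_subproof (E : conn) : is_chom (@id E).
Proof. by []. Qed.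

Lemma chom_comp_subproof (E F G : conn) (g : chom F G) (f : chom E F) :
  is_chom (val g \o val f).
Proof.
have [[gl gn] [fl fn]] := (chomP g, chomP f).
by split=> [a x y|x e] /=; rewrite ?fl ?gl ?fn ?gn.
Qed.

Program Definition conn0 : conn :=
  @Connection ('rV[A]_0 : lmodType A) (fun _ e => e) _ _ _.
Next Obligation. by move=> *; apply/rowP => -[]. Qed.
Next Obligation. by move=> *; apply/rowP => -[]. Qed.

Program Definition conn_sum (E F : conn) : conn :=
  @Connection ((E * F)%type : lmodType A)
    (fun x e => (nabla x e.1, nabla x e.2)) _ _ _.
Next Obligation. by move=> *; congr pair; apply: nabla_klin. Qed.
Next Obligation. by move=> *; congr pair; apply: nabla_lin. Qed.
Next Obligation. by move=> *; congr pair; apply: nabla_leibniz. Qed.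

Lemma chom_in1 (E F : conn) :
  @is_chom E (conn_sum E F) (fun x => (x, 0 : F)).
Proof.
by split=> [|x e]; [exact: linear_in1 | congr pair; rewrite /= nabla0].
Qed.

Lemma chom_in2 (E F : conn) :
  @is_chom F (conn_sum E F) (fun y => (0 : E, y)).
Proof.
by split=> [|x e]; [exact: linear_in2 | congr pair; rewrite /= nabla0].
Qed.

Lemma chom_pr1 (E F : conn) : @is_chom (conn_sum E F) E fst.
Proof. by []. Qed.

Lemma chom_pr2 (E F : conn) : @is_chom (conn_sum E F) F snd.
Proof. by []. Qed.

Definition Conn : addCat.
Proof.
refine (@AddCat conn chom
  (fun E => mk_chom (chom_id_subproof E))
  (fun E F G g f => mk_chom (chom_comp_subproof g f))
  _ _ _ _ _ conn0 _ conn_sum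
  (fun E F => mk_chom (chom_in1 E F))
  (fun E F => mk_chom (chom_in2 E F))
  (fun E F => mk_chom (chom_pr1 E F))
  (fun E F => mk_chom (chom_pr2 E F)) _ _ _).
- by move=> *; apply: chom_eq.
- by move=> *; apply: chom_eq.
- by move=> *; apply: chom_eq.
- by move=> *; apply: chom_eq.
- move=> E F G g f f'; apply: chom_eq => x /=.
  by have [/(_ 1 (val f x) (val f' x)) + _] := chomP g; rewrite !scale1r.
- by apply: chom_eq => x; apply/rowP => -[].
- by move=> *; apply: chom_eq.
- by move=> *; apply: chom_eq.
- move=> E F; apply: chom_eq => -[x y].
  by congr pair; rewrite /= ?addr0 ?add0r.
Defined.

End Connections.
End LieRinehart.

Arguments anchor {k A phi l} : rename.

Section TensorAlgebra.
Variables (k : comPzRingType) (V : lmodType k).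

Inductive tterm :=
  | TGen of V | TCst of k | TAdd of tterm & tterm | TMul of tterm & tterm.

(* The congruence generated by the axioms of unital associative k-algebras and
   by the k-linearity of [TGen]. *)
Inductive teq : tterm -> tterm -> Prop :=
  | teq_refl t : teq t t
  | teq_sym s t : teq s t -> teq t s
  | teq_trans s t u : teq s t -> teq t u -> teq s u
  | teq_add s s' t t' : teq s s' -> teq t t' -> teq (TAdd s t) (TAdd s' t')
  | teq_mul s s' t t' : teq s s' -> teq t t' -> teq (TMul s t) (TMul s' t')
  | teq_addA s t u : teq (TAdd s (TAdd t u)) (TAdd (TAdd s t) u)
  | teq_addC s t : teq (TAdd s t) (TAdd t s)
  | teq_add0 t : teq (TAdd (TCst 0) t) t
  | teq_addN t : teq (TAdd (TMul (TCst (- 1)) t) t) (TCst 0)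
  | teq_mulA s t u : teq (TMul s (TMul t u)) (TMul (TMul s t) u)
  | teq_mul1l t : teq (TMul (TCst 1) t) t
  | teq_mul1r t : teq (TMul t (TCst 1)) t
  | teq_mulDl s t u : teq (TMul (TAdd s t) u) (TAdd (TMul s u) (TMul t u))
  | teq_mulDr s t u : teq (TMul s (TAdd t u)) (TAdd (TMul s t) (TMul s u))
  | teq_cstD a b : teq (TCst (a + b)) (TAdd (TCst a) (TCst b))
  | teq_cstM a b : teq (TCst (a * b)) (TMul (TCst a) (TCst b))
  | teq_cstC a t : teq (TMul (TCst a) t) (TMul t (TCst a))
  | teq_genD v w : teq (TGen (v + w)) (TAdd (TGen v) (TGen w))
  | teq_genZ a v : teq (TGen (a *: v)) (TMul (TCst a) (TGen v)).

Definition ttermc := {classic tterm}.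
Definition teqb (s t : ttermc) : bool := `[< teq s t >].

Lemma teqb_equiv : equiv_class_of teqb.
Proof.
split=> [s|s t|t s u]; first exact/asboolP/teq_refl.
  by apply/asboolP/asboolP => /teq_sym.
by move=> /asboolP st /asboolP tu; exact/asboolP/(teq_trans st tu).
Qed.
Canonical teqb_equiv_rel := EquivRelPack teqb_equiv.

(* The tensor algebra T_k(V), presented by generators and relations; see
   [tens_univ] for its universal property. *)
Definition tens : Type := {eq_quot teqb}.
HB.instance Definition _ := Choice.on tens.

Definition tpi (t : ttermc) : tens := \pi_({eq_quot teqb}) t.

Lemma tpi_eq s t : teq s t -> tpi s = tpi t.
Proof. by move=> st; apply/eqmodP/asboolP. Qed.

Lemma tpi_repr (t : tens) : tpi (repr t) = t.
Proof. exact: reprK. Qed.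

Lemma repr_tpi t : teq (repr (tpi t)) t.
Proof. by apply/asboolP; have /eqmodP := reprK (tpi t). Qed.

Definition tadd (s t : tens) : tens := tpi (TAdd (repr s) (repr t)).
Definition tmul (s t : tens) : tens := tpi (TMul (repr s) (repr t)).
Definition tcst (a : k) : tens := tpi (TCst a).
Definition tgen (v : V) : tens := tpi (TGen v).

Lemma taddE s t : tadd (tpi s) (tpi t) = tpi (TAdd s t).
Proof. by apply/tpi_eq/teq_add; exact: repr_tpi. Qed.
Lemma tmulE s t : tmul (tpi s) (tpi t) = tpi (TMul s t).
Proof. by apply/tpi_eq/teq_mul; exact: repr_tpi. Qed.

Lemma taddA : associative tadd.
Proof.
move=> s t u; rewrite -[s]tpi_repr -[t]tpi_repr -[u]tpi_repr !taddE.
exact/tpi_eq/teq_addA.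
Qed.
Lemma taddC : commutative tadd.
Proof. by move=> s t; exact/tpi_eq/teq_addC. Qed.
Lemma tadd0 : left_id (tcst 0) tadd.
Proof. by move=> t; rewrite -[t]tpi_repr taddE; exact/tpi_eq/teq_add0. Qed.
Lemma tmulA : associative tmul.
Proof.
move=> s t u; rewrite -[s]tpi_repr -[t]tpi_repr -[u]tpi_repr !tmulE.
exact/tpi_eq/teq_mulA.
Qed.
Lemma tmul1l : left_id (tcst 1) tmul.
Proof. by move=> t; rewrite -[t]tpi_repr tmulE; exact/tpi_eq/teq_mul1l. Qed.
Lemma tmul1r : right_id (tcst 1) tmul.
Proof. by move=> t; rewrite -[t]tpi_repr tmulE; exact/tpi_eq/teq_mul1r. Qed.
Lemma tmulDl : left_distributive tmul tadd.
Proof.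
move=> s t u; rewrite -[s]tpi_repr -[t]tpi_repr -[u]tpi_repr.
by rewrite !(taddE, tmulE); exact/tpi_eq/teq_mulDl.
Qed.
Lemma tmulDr : right_distributive tmul tadd.
Proof.
move=> s t u; rewrite -[s]tpi_repr -[t]tpi_repr -[u]tpi_repr.
by rewrite !(taddE, tmulE); exact/tpi_eq/teq_mulDr.
Qed.
Lemma tcstD a b : tcst (a + b) = tadd (tcst a) (tcst b).
Proof. by rewrite taddE; exact/tpi_eq/teq_cstD. Qed.
Lemma tcstM a b : tcst (a * b) = tmul (tcst a) (tcst b).
Proof. by rewrite tmulE; exact/tpi_eq/teq_cstM. Qed.
Lemma tcstC a t : tmul (tcst a) t = tmul t (tcst a).
Proof. by rewrite -[t]tpi_repr !tmulE; exact/tpi_eq/teq_cstC. Qed.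

Definition topp (t : tens) : tens := tmul (tcst (-1)) t.

Lemma taddN : left_inverse (tcst 0) topp tadd.
Proof.
by move=> t; rewrite -[t]tpi_repr /topp tmulE taddE; exact/tpi_eq/teq_addN.
Qed.

HB.instance Definition _ := GRing.isPzRing.Build tens
  taddA taddC tadd0 taddN tmulA tmul1l tmul1r tmulDl tmulDr.

Lemma tcst_zmod_morphism : zmod_morphism tcst.
Proof.
move=> a b; apply: (addIr (tcst b)); rewrite subrK.
by rewrite -[LHS]tcstD subrK.
Qed.
Lemma tcst_monoid_morphism : monoid_morphism tcst.
Proof. by split=> // a b; exact: tcstM. Qed.
HB.instance Definition _ := GRing.isZmodMorphism.Build k tens tcst
  tcst_zmod_morphism.
HB.instance Definition _ := GRing.isMonoidMorphism.Build k tens tcst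
  tcst_monoid_morphism.

Lemma tgenD v w : tgen (v + w) = tgen v + tgen w.
Proof. by rewrite [RHS]taddE; exact/tpi_eq/teq_genD. Qed.
Lemma tgenZ a v : tgen (a *: v) = tcst a * tgen v.
Proof. by rewrite [RHS]tmulE; exact/tpi_eq/teq_genZ. Qed.

Section Universal.
Variables (B : pzRingType) (iota : {rmorphism k -> B}) (g : V -> B).
Hypothesis iotaC : forall a b, iota a * b = b * iota a.
Hypothesis gD : forall v w, g (v + w) = g v + g w.
Hypothesis gZ : forall a v, g (a *: v) = iota a * g v.

Fixpoint teval (t : tterm) : B :=
  match t with
  | TGen v => g v
  | TCst a => iota a
  | TAdd s t => teval s + teval t
  | TMul s t => teval s * teval t
  end.

Lemma teval_eq s t : teq s t -> teval s = teval t.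
Proof.
elim=> //= {s t}; try by move=> *; congruence.
- by move=> s t u; rewrite addrA.
- by move=> s t; rewrite addrC.
- by move=> t; rewrite rmorph0 add0r.
- by move=> t; rewrite rmorph0 rmorphN rmorph1 mulN1r addNr.
- by move=> s t u; rewrite mulrA.
- by move=> t; rewrite rmorph1 mul1r.
- by move=> t; rewrite rmorph1 mulr1.
- by move=> s t u; rewrite mulrDl.
- by move=> s t u; rewrite mulrDr.
- by move=> a b; rewrite rmorphD.
- by move=> a b; rewrite rmorphM.
Qed.

Definition tens_lift (t : tens) : B := teval (repr t).

Lemma tens_liftE t : tens_lift (tpi t) = teval t.
Proof. exact/teval_eq/repr_tpi. Qed.

Lemma tens_lift_zmod_morphism : zmod_morphism tens_lift.
Proof.
move=> s t; rewrite -[s]tpi_repr -[t]tpi_repr.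
have -> : tpi (repr s) - tpi (repr t) =
          tpi (TAdd (repr s) (TMul (TCst (-1)) (repr t))).
  by rewrite -taddE -tmulE.
by rewrite !tens_liftE /= rmorphN rmorph1 mulN1r.
Qed.
Lemma tens_lift_monoid_morphism : monoid_morphism tens_lift.
Proof.
split=> [|s t]; first by rewrite tens_liftE /= rmorph1.
by rewrite -[s]tpi_repr -[t]tpi_repr [X in tens_lift X]tmulE !tens_liftE.
Qed.
HB.instance Definition _ := GRing.isZmodMorphism.Build tens B tens_lift
  tens_lift_zmod_morphism.
HB.instance Definition _ := GRing.isMonoidMorphism.Build tens B tens_lift
  tens_lift_monoid_morphism.

Lemma tens_univ : exists h : {rmorphism tens -> B},
  [/\ forall a, h (tcst a) = iota a, forall v, h (tgen v) = g v &
      forall h' : {rmorphism tens -> B},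
        (forall a, h' (tcst a) = iota a) -> (forall v, h' (tgen v) = g v) ->
        h' =1 h].
Proof.
exists tens_lift; split=> [a|v|h' h'c h'g t]; try exact: tens_liftE.
rewrite -[t]tpi_repr [RHS]tens_liftE; elim: (repr t : tterm) => //= s IHs u IHu.
  by rewrite -IHs -IHu -rmorphD; congr (h' _); rewrite [RHS]taddE.
by rewrite -IHs -IHu -rmorphM; congr (h' _); rewrite [RHS]tmulE.
Qed.

End Universal.
End TensorAlgebra.

Section QuotientRing.
Variables (R : pzRingType) (S : R -> Prop).

Definition two_sided_ideal (I : R -> Prop) :=
  [/\ I 0, forall x y, I x -> I y -> I (x - y) &
      forall a x, I x -> I (a * x) /\ I (x * a)].

Definition gen_ideal : {pred R} :=
  [pred x | `[< forall I, two_sided_ideal I -> (forall y, S y -> I y) -> I x >]].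

Lemma gen_idealP x :
  reflect (forall I, two_sided_ideal I -> (forall y, S y -> I y) -> I x)
          (x \in gen_ideal).
Proof. exact: asboolP. Qed.

Lemma gen_ideal_zmod_closed : zmod_closed gen_ideal.
Proof.
split=> [|x y /gen_idealP Ix /gen_idealP Iy]; apply/gen_idealP => I idI SI.
  by case: idI.
by have [_ + _] := idI; apply; [exact: Ix | exact: Iy].
Qed.
HB.instance Definition _ :=
  GRing.isZmodClosed.Build R gen_ideal gen_ideal_zmod_closed.

Lemma gen_idealMl a x : x \in gen_ideal -> a * x \in gen_ideal.
Proof.
move=> /gen_idealP Ix; apply/gen_idealP => I idI SI.
by have [_ _ /(_ a x (Ix I idI SI))[]] := idI.
Qed.

Lemma gen_idealMr a x : x \in gen_ideal -> x * a \in gen_ideal.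
Proof.
move=> /gen_idealP Ix; apply/gen_idealP => I idI SI.
by have [_ _ /(_ a x (Ix I idI SI))[]] := idI.
Qed.

Lemma mem_gen_ideal x : S x -> x \in gen_ideal.
Proof. by move=> Sx; apply/gen_idealP => I _; apply. Qed.

Definition quot_ring : Type := Quotient.quot gen_ideal.
HB.instance Definition _ := GRing.Zmodule.on quot_ring.

Definition qpi (x : R) : quot_ring := \pi_(Quotient.quot gen_ideal) x.

Lemma qpi_eq x y : (qpi x = qpi y) <-> (x - y \in gen_ideal).
Proof. by rewrite Quotient.idealrBE; exact: (rwP eqP). Qed.

Lemma qpi_repr (q : quot_ring) : qpi (repr q) = q.
Proof. exact: reprK. Qed.

Lemma qpiD x y : qpi (x + y) = qpi x + qpi y.
Proof. exact: raddfD. Qed.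

Definition qmul (p q : quot_ring) : quot_ring := qpi (repr p * repr q).

Lemma qmulE x y : qmul (qpi x) (qpi y) = qpi (x * y).
Proof.
apply/qpi_eq; set x' := repr _; set y' := repr _.
have -> : x' * y' - x * y = x' * (y' - y) + (x' - x) * y.
  by rewrite mulrBr mulrBl addrA subrK.
by apply: rpredD; [apply: gen_idealMl | apply: gen_idealMr];
  apply/qpi_eq/qpi_repr.
Qed.

Lemma qmulA : associative qmul.
Proof.
move=> p q r; rewrite -[p]qpi_repr -[q]qpi_repr -[r]qpi_repr.
by rewrite !qmulE mulrA.
Qed.
Lemma qmul1l : left_id (qpi 1) qmul.
Proof. by move=> q; rewrite -[q]qpi_repr qmulE mul1r. Qed.
Lemma qmul1r : right_id (qpi 1) qmul.
Proof. by move=> q; rewrite -[q]qpi_repr qmulE mulr1. Qed.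
Lemma qmulDl : left_distributive qmul +%R.
Proof.
move=> p q r; rewrite -[p]qpi_repr -[q]qpi_repr -[r]qpi_repr.
by rewrite -qpiD !qmulE mulrDl qpiD.
Qed.
Lemma qmulDr : right_distributive qmul +%R.
Proof.
move=> p q r; rewrite -[p]qpi_repr -[q]qpi_repr -[r]qpi_repr.
by rewrite -qpiD !qmulE mulrDr qpiD.
Qed.
HB.instance Definition _ := GRing.Zmodule_isPzRing.Build quot_ring
  qmulA qmul1l qmul1r qmulDl qmulDr.

End QuotientRing.

Section UniversalRing.
Variables (k A : comPzRingType) (phi : {rmorphism k -> A}).

Definition rest_scal (M : lmodType A) : Type := M.
HB.instance Definition _ M := GRing.Zmodule.on (rest_scal M).

Section RestrictScalars.
Variable M : lmodType A.
Definition rest_scale (l : k) (x : rest_scal M) : rest_scal M :=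
  phi l *: (x : M).
Lemma rest_scaleA a b x : rest_scale a (rest_scale b x) = rest_scale (a * b) x.
Proof. by rewrite /rest_scale scalerA rmorphM. Qed.
Lemma rest_scale1 : left_id 1 rest_scale.
Proof. by move=> x; rewrite /rest_scale rmorph1 scale1r. Qed.
Lemma rest_scaleDr : right_distributive rest_scale +%R.
Proof. by move=> a x y; rewrite /rest_scale scalerDr. Qed.
Lemma rest_scaleDl x : {morph rest_scale^~ x : a b / a + b}.
Proof. by move=> a b; rewrite /rest_scale rmorphD scalerDl. Qed.
Definition rest_lmod : lmodType k :=
  HB.pack (rest_scal M) (GRing.Zmodule_isLmodule.Build k (rest_scal M)
    rest_scaleA rest_scale1 rest_scaleDr rest_scaleDl).
End RestrictScalars.

(* The bare operations of a D-Lie algebra: left and right A-actions, bracket, and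
   central element. *)
Record dLieOps := DLieOps {
  dlie :> lmodType A;
  ract : dlie -> A -> dlie;
  dbrk : dlie -> dlie -> dlie;
  dz : dlie
}.

(* L_c = L(alpha^* c) = Az (+) L; the pair (a, x) stands for az + x. *)
Definition Lc (L : lieRinehart phi) (c : cocycle2 phi) : dLieOps :=
  @DLieOps ((A^o * L)%type : lmodType A)
    (fun v b => (v.1 * b + der_ev (anchor v.2) b, b *: v.2))
    (fun v w => (der_ev (anchor v.2) w.1 - der_ev (anchor w.2) v.1
                   + c (anchor v.2) (anchor w.2),
                 brk v.2 w.2))
    (1, 0).

Variable D : dLieOps.

Definition dgen (v : D) : tens (rest_lmod D) := tgen (v : rest_lmod D).

Inductive J1_gen : tens (rest_lmod D) -> Prop :=
  | J1_unit : J1_gen (dgen (dz D) - 1)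
  | J1_left (a : A) (u : D) :
      J1_gen (dgen (a *: u) - dgen (a *: dz D) * dgen u)
  | J1_right (v : D) (b : A) :
      J1_gen (dgen (ract v b) - dgen v * dgen (b *: dz D)).

Definition Utens : pzRingType := quot_ring J1_gen.

End UniversalRing.

(* Main.v *)
From Pilot Require Import Defs.
From HB Require Import structures.
From mathcomp Require Import all_boot all_algebra.
From mathcomp Require Import boolp classical_sets functions.
From Stdlib Require Import Relation_Operators.
(* Again, as the algebra library shadows names such as [hom]. *)
Import Pilot.Defs.

Set Implicit Arguments.
Unset Strict Implicit.
Unset Printing Implicit Defensive.

Import GRing.Theory.
Local Open Scope ring_scope.
Local Open Scope quotient_scope.
Local Open Scope cat_scope.

(** A left module over U(L_c) is an additive group with operators az + x; the
    relations of J_1 say precisely that the az act as scalars in A and that the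
    x act as a connection.  The bracket of L_c does not occur in J_1, so no
    flatness is imposed and the cocycle c plays no role.

    The rest is formal.  An additive equivalence transports the abelian axioms
    and projective resolutions.  In an abelian category, lifting the identity of
    A from a projective resolution P to an n-fold extension s of A by B yields
    cocycles P_n --> B, which form one cohomology class, invariant under
    morphisms of extensions.  Conversely, pushing out P along a cocycle f yields
    an extension s_f that maps to every extension with cocycle f.  Baer sums are
    computed on such push-outs. *)

(** * Additive categories *)

Section AdditiveCategory.
Variable C : addCat.
Implicit Types X Y Z W : C.

Lemma comp0l X Y Z (f : hom X Y) : (0 : hom Y Z) \oc f = 0.
Proof. by apply: (addrI (0 \oc f)); rewrite -compDl !addr0. Qed.
Lemma comp0r X Y Z (g : hom Y Z) : g \oc (0 : hom X Y) = 0.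
Proof. by apply: (addrI (g \oc 0)); rewrite -compDr !addr0. Qed.
Lemma compNl X Y Z (g : hom Y Z) (f : hom X Y) : (- g) \oc f = - (g \oc f).
Proof. by apply: (addrI (g \oc f)); rewrite -compDl !subrr comp0l. Qed.
Lemma compNr X Y Z (g : hom Y Z) (f : hom X Y) : g \oc (- f) = - (g \oc f).
Proof. by apply: (addrI (g \oc f)); rewrite -compDr !subrr comp0r. Qed.
Lemma compBl X Y Z (g g' : hom Y Z) (f : hom X Y) :
  (g - g') \oc f = g \oc f - g' \oc f.
Proof. by rewrite compDl compNl. Qed.
Lemma compBr X Y Z (g : hom Y Z) (f f' : hom X Y) :
  g \oc (f - f') = g \oc f - g \oc f'.
Proof. by rewrite compDr compNr. Qed.

Lemma mono0 X Y (f : hom X Y) :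
  mono f <-> forall W (h : hom W X), f \oc h = 0 -> h = 0.
Proof.
split=> [mf W h fh|f0 W h h' fh]; first by apply: mf; rewrite fh comp0r.
by apply/eqP; rewrite -subr_eq0; apply/eqP/f0; rewrite compBr fh subrr.
Qed.

Lemma epi0 X Y (f : hom X Y) :
  epi f <-> forall W (h : hom Y W), h \oc f = 0 -> h = 0.
Proof.
split=> [mf W h fh|f0 W h h' fh]; first by apply: mf; rewrite fh comp0l.
by apply/eqP; rewrite -subr_eq0; apply/eqP/f0; rewrite compBl fh subrr.
Qed.

Lemma mono_comp X Y Z (g : hom Y Z) (f : hom X Y) :
  mono g -> mono f -> mono (g \oc f).
Proof. by move=> mg mf W h h'; rewrite -!compA => /mg/mf. Qed.

Lemma epi_comp X Y Z (g : hom Y Z) (f : hom X Y) :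
  epi g -> epi f -> epi (g \oc f).
Proof. by move=> eg ef W h h'; rewrite !compA => /ef/eg. Qed.

Lemma epi_compl X Y Z (g : hom Y Z) (f : hom X Y) : epi (g \oc f) -> epi g.
Proof. by move=> e W h h' eq; apply: e; rewrite !compA eq. Qed.

Lemma mono_compr X Y Z (g : hom Y Z) (f : hom X Y) : mono (g \oc f) -> mono f.
Proof. by move=> e W h h' eq; apply: e; rewrite -!compA eq. Qed.

Lemma epi_idm X : epi (idm X).
Proof. by move=> W h h'; rewrite !comp1r. Qed.

(** Uniqueness of factorizations is the same as [i] being mono: if [i \oc h = 0], then [h] and 0
    both factor the zero map. *)
Lemma is_kernelP K Y Z (g : hom Y Z) (i : hom K Y) :
  is_kernel g i <-> [/\ g \oc i = 0, mono i &
    forall W (h : hom W Y), g \oc h = 0 -> exists l, h = i \oc l].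
Proof.
split=> [[gi U]|[gi mi U]]; split=> //; last first.
- by move=> W h /U[l hl]; exists l; split=> // l' hl'; apply: mi; rewrite -hl.
- by move=> W h /U[l [hl _]]; exists l.
apply/mono0 => W h ih; have [|l [_ ul]] := U W 0; first exact: comp0r.
by rewrite -(ul h) ?ih // -(ul 0) ?comp0r.
Qed.

Definition is_cokernel Y Z Q (g : hom Y Z) (p : hom Z Q) :=
  [/\ p \oc g = 0, epi p &
    forall W (h : hom Z W), h \oc g = 0 -> exists l, h = l \oc p].

(** The zero object and the biproducts already belong to [addCat]. *)
Definition abelian :=
  [/\ forall Y Z (g : hom Y Z), exists K (i : hom K Y), is_kernel g i,
      forall Y Z (g : hom Y Z), exists Q (p : hom Z Q), is_cokernel g p,
      forall X Y (f : hom X Y), mono f -> exists Z (g : hom Y Z), is_kernel g f &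
      forall X Y (f : hom X Y), epi f -> exists W (g : hom W X), is_cokernel g f].

Lemma kernel_mono K Y Z (g : hom Y Z) (i : hom K Y) : is_kernel g i -> mono i.
Proof. by move/is_kernelP=> []. Qed.

Lemma exact_comp X Y Z (f : hom X Y) (g : hom Y Z) :
  exact_at f g -> g \oc f = 0.
Proof. by move=> [K [i [e [[gi _] -> _]]]]; rewrite compA gi comp0l. Qed.

(** The map [u] factors through the kernel of [g], and projectivity lifts the factor along the
    epimorphism from X onto that kernel. *)
Lemma exact_lift X Y Z P (f : hom X Y) (g : hom Y Z) (u : hom P Y) :
  exact_at f g -> projective P -> g \oc u = 0 -> exists v, u = f \oc v.
Proof.
move=> [K [i [e [/is_kernelP[_ _ U] -> ee]]]] pP /U[l ->].
by have [v ->] := pP _ _ e ee l; exists v; rewrite compA.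
Qed.

Lemma exact_post X Y Z Z' (f : hom X Y) (g : hom Y Z) (m : hom Z Z') :
  mono m -> exact_at f g -> exact_at f (m \oc g).
Proof.
move=> mm [K [i [e [/is_kernelP[gi mi U] fe ee]]]].
exists K, i, e; split=> //; apply/is_kernelP; split=> //.
  by rewrite -compA gi comp0r.
by move=> W h; rewrite -compA => /((mono0 _).1 mm)/U.
Qed.

(** Sandwiching [dsum_id] between [pr2] and [in1] gives t + t = t for t the composite. *)
Lemma pr2_in1 X Y : pr2 X Y \oc in1 X Y = 0.
Proof.
have := congr1 (fun k => pr2 X Y \oc k \oc in1 X Y) (dsum_id X Y).
rewrite /= comp1r compDr compDl !compA pr2_in2 comp1l -(compA (pr2 X Y \oc in1 X Y)) pr1_in1.
by rewrite comp1r -[RHS]addr0 => /addrI.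
Qed.
Lemma pr1_in2 X Y : pr1 X Y \oc in2 X Y = 0.
Proof.
have := congr1 (fun k => pr1 X Y \oc k \oc in2 X Y) (dsum_id X Y).
rewrite /= comp1r compDr compDl !compA pr1_in1 comp1l -(compA (pr1 X Y \oc in2 X Y)) pr2_in2.
by rewrite comp1r -[RHS]add0r => /addIr.
Qed.

Lemma dsum_ext X Y W (h h' : hom (dsum X Y) W) :
  h \oc in1 X Y = h' \oc in1 X Y -> h \oc in2 X Y = h' \oc in2 X Y -> h = h'.
Proof.
move=> h1 h2; rewrite -[h]comp1r -[h']comp1r -dsum_id !compDr !compA.
by rewrite h1 h2.
Qed.

End AdditiveCategory.

(** * Lifting maps from acyclic complexes to sequences *)

Section Complexes.
Variable C : addCat.
Implicit Types X Y Z W B : C.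

Record cplx := Cplx {
  cob : nat -> C;
  cd : forall j, hom (cob j.+1) (cob j)
}.

Definition shift (Q : cplx) := Cplx (fun j => cd Q j.+1).

Definition acyclic (Q : cplx) := forall j, exact_at (cd Q j.+1) (cd Q j).

Lemma acyclic_comp (Q : cplx) j : acyclic Q -> cd Q j \oc cd Q j.+1 = 0.
Proof. by move=> aQ; apply: exact_comp. Qed.

(* [f] is the last component of a morphism of sequences from
   Q_(n+1) --> ... --> Q_0 to B --> E_n --> ... --> E_1 --> X starting with [u]. *)
Fixpoint lifts B n : forall (Q : cplx) X (u : hom (cob Q 0) X),
    lseq B n X -> hom (cob Q n.+1) B -> Prop :=
  match n with
  | 0 => fun Q X u s f => s \oc f = u \oc cd Q 0
  | m.+1 => fun Q X u s f => exists v : hom (cob Q 1) (projT1 s),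
      (projT2 s).1 \oc v = u \oc cd Q 0 /\
      @lifts B m (shift Q) _ v (projT2 s).2 f
  end.

Lemma lifts_add B n (Q : cplx) X (u u' : hom (cob Q 0) X) (s : lseq B n X) f f' :
  lifts u s f -> lifts u' s f' -> lifts (u + u') s (f + f').
Proof.
elim: n Q X u u' s f f' => [|n IH] Q X u u' s f f' /=.
  by move=> sf sf'; rewrite compDl compDr sf sf'.
move=> [v [hv vf]] [v' [hv' vf']]; exists (v + v'); split; last exact: IH.
by rewrite compDl compDr hv hv'.
Qed.

Lemma lifts_opp B n (Q : cplx) X (u : hom (cob Q 0) X) (s : lseq B n X) f :
  lifts u s f -> lifts (- u) s (- f).
Proof.
elim: n Q X u s f => [|n IH] Q X u s f /=.
  by move=> sf; rewrite compNl compNr sf.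
move=> [v [hv vf]]; exists (- v); split; last exact: IH.
by rewrite compNl compNr hv.
Qed.

Lemma lifts_sub B n (Q : cplx) X (u u' : hom (cob Q 0) X) (s : lseq B n X) f f' :
  lifts u s f -> lifts u' s f' -> lifts (u - u') s (f - f').
Proof. by move=> l /lifts_opp; exact: lifts_add. Qed.

(** All later components can be taken to be zero. *)
Lemma lifts0 B n (Q : cplx) X (u : hom (cob Q 0) X) (s : lseq B n X) :
  u \oc cd Q 0 = 0 -> lifts u s 0.
Proof.
elim: n Q X u s => [|n IH] Q X u s /= ->; first by rewrite comp0r.
by exists 0; split; [rewrite comp0r | apply: IH; rewrite comp0l].
Qed.

Lemma lifts_lmor B B' (b : hom B B') n (Q : cplx) X X' (x : hom X X')
    (u : hom (cob Q 0) X) (s : lseq B n X) (t : lseq B' n X') f :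
  lmor b x s t -> lifts u s f -> lifts (x \oc u) t (b \oc f).
Proof.
elim: n Q X X' x u s t f => [|n IH] Q X X' x u s t f /=.
  by move=> xs sf; rewrite compA -xs -!compA sf.
move=> [w [xw wl]] [v [hv vf]]; exists (w \oc v); split; last exact: IH vf.
by rewrite compA -xw -!compA hv.
Qed.

(** Existence half of the comparison theorem: each component composed with the next differential is
    killed by the map out of its target, so exactness and projectivity provide the next
    component. *)
Lemma lifts_exists B n (Q : cplx) X Y (g : hom X Y) (u : hom (cob Q 0) X)
    (s : lseq B n X) :
  acyclic Q -> (forall j, projective (cob Q j.+1)) ->
  lexact g s -> g \oc (u \oc cd Q 0) = 0 -> exists f, lifts u s f.
Proof.
elim: n Q X Y g u s => [|n IH] Q X Y g u s aQ pQ /=.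
  by move=> [_ es] /(exact_lift es (pQ 0%N))[f ->]; exists f.
move=> [es ls] /(exact_lift es (pQ 0%N))[v uv].
have [|||f fP] // := IH (shift Q) _ _ _ v _ _ _ ls.
- by move=> j; exact: (aQ j.+1).
- by move=> j; exact: (pQ j.+1).
- by rewrite compA -uv -compA (acyclic_comp 0 aQ) comp0r.
by exists f, v.
Qed.

(** Since two consecutive differentials compose to zero, so does the composite after B --> E_n,
    which is mono. *)
Lemma lifts_cocycle B n (Q : cplx) X Y (g : hom X Y) (u : hom (cob Q 0) X)
    (s : lseq B n X) f :
  acyclic Q -> lexact g s -> lifts u s f -> f \oc cd Q n.+1 = 0.
Proof.
elim: n Q X Y g u s f => [|n IH] Q X Y g u s f aQ /=.
  move=> [ms _] sf; apply/(mono0 s).1 => //.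
  by rewrite compA sf -compA (acyclic_comp 0 aQ) comp0r.
move=> [_ ls] [v [_ vf]]; apply: (IH (shift Q)) ls vf => j; exact: (aQ j.+1).
Qed.

(** Uniqueness half of the comparison theorem. The maps [r] form a contracting homotopy, built one
    degree at a time; its last component is the required [w]. *)
Lemma lifts_null B n (Q : cplx) X Y (g : hom X Y) (u : hom (cob Q 0) X)
    (s : lseq B n X) f :
  acyclic Q -> (forall j, projective (cob Q j)) ->
  lexact g s -> g \oc u = 0 -> lifts u s f ->
  exists w, f = w \oc cd Q n.
Proof.
elim: n Q X Y g u s f => [|n IH] Q X Y g u s f aQ pQ /=.
  move=> [ms es] /(exact_lift es (pQ 0%N))[r ->] sf.
  by exists r; apply: ms; rewrite sf compA.
move=> [es ls] /(exact_lift es (pQ 0%N))[r ->] [v [hv vf]].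
apply: (IH (shift Q) _ _ _ (v - r \oc cd Q 0) _ _ _ _ ls) => [j|j||].
- exact: (aQ j.+1).
- exact: (pQ j.+1).
- by rewrite compBr hv compA subrr.
(* Correcting [v] by [r \oc cd Q 0] does not change [f], because 0 is a last component for the
   correction. *)
- rewrite -[f]subr0; apply: lifts_sub => //; apply: lifts0.
  by rewrite -compA (acyclic_comp 0 aQ) comp0r.
Qed.

(** The lift is zero except at the term next to B, where it is [w] followed by the inclusion of B.
    Adding it to another lift changes the cocycle by a coboundary. *)
Lemma lifts_cobound B n (Q : cplx) X Y (g : hom X Y) (s : lseq B n X)
    (w : hom (cob Q n) B) :
  lexact g s -> exists a, g \oc a = 0 /\ lifts a s (w \oc cd Q n).
Proof.
elim: n Q X Y g s w => [|n IH] Q X Y g s w /=.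
  move=> [_ es]; exists (s \oc w); split; last by rewrite compA.
  by rewrite compA (exact_comp es) comp0l.
move=> [_ /(IH (shift Q) _ _ _ _ w)[a [ha al]]].
by exists 0; rewrite comp0r; split=> //; exists a; rewrite comp0l.
Qed.

End Complexes.

(** * Push-outs in an abelian category *)

Section StandardExtension.
Variable C : addCat.
Hypothesis abC : abelian C.
Implicit Types X Y Z W B : C.

Lemma kernel_of_cokernel X Y Z (f : hom X Y) (p : hom Y Z) :
  mono f -> is_cokernel f p -> is_kernel p f.
Proof.
have [_ _ mn _] := abC => mf [pf _ pU]; apply/is_kernelP; split=> //.
have [V [g /is_kernelP[gf _ gU]]] := mn _ _ _ mf.
move=> W h ph; apply: gU; have [g' ->] := pU _ g gf.
by rewrite -compA ph comp0r.
Qed.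

(** As [e] is the cokernel of some [g], it is enough to test [hr] on [g]. This replaces arguments
    with elements. *)
Lemma epi_factor X Y Z (e : hom X Y) (h : hom X Z) :
  epi e -> (forall W (r : hom W X), e \oc r = 0 -> h \oc r = 0) ->
  exists l, h = l \oc e.
Proof.
have [_ _ _ en] := abC => ee hr.
by have [W [g [eg _ U]]] := en _ _ _ ee; apply/U/hr.
Qed.

(* E is the cokernel of (f, -j) : K --> B (+) Y, where j : K --> Y is the kernel
   of e, through which d and f factor. *)
Lemma pushout_extension X' X Y I B (d' : hom X' X) (d : hom X Y) (e : hom Y I)
    (f : hom X B) :
  exact_at d' d -> exact_at d e -> epi e -> f \oc d' = 0 ->
  exists E (m : hom B E) (p : hom Y E) (q : hom E I),
    [/\ mono m, is_kernel q m, m \oc f = p \oc d, q \oc p = e &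
      (forall T (h h' : hom E T), h \oc m = h' \oc m -> h \oc p = h' \oc p ->
         h = h') /\
      forall T (b : hom B T) (y : hom Y T), b \oc f = y \oc d ->
        exists t, t \oc m = b /\ t \oc p = y].
Proof.
have [_ ck mn _] := abC.
move=> [K' [i' [e' [/is_kernelP[di' _ dU'] d'E ee']]]].
move=> [K [j [eX [jK dE eeX]]]] ee fd'.
have [ej mj jU] := (is_kernelP _ _).1 jK.
(* The map [f] descends to K: whatever [eX] kills is killed by [d], hence factors through [i'], and
   [f] vanishes on [i'] because [e'] is epi. *)
have [fb fE] : exists fb, f = fb \oc eX.
  apply: epi_factor => // W r er.
  have /dU'[l ->] : d \oc r = 0 by rewrite dE -compA er comp0r.
  rewrite compA; suff -> : f \oc i' = 0 by rewrite comp0l.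
  by apply: ee'; rewrite comp0l -compA -d'E.
pose a := in1 B Y \oc fb - in2 B Y \oc j.
have pr2a : pr2 B Y \oc a = - j.
  by rewrite compBr !compA pr2_in1 pr2_in2 comp0l comp1l sub0r.
have ma : mono a.
  apply/mono0 => W h ah; apply/(mono0 j).1 => //.
  by apply: oppr_inj; rewrite -compNl -pr2a -compA ah comp0r oppr0.
have [E [c cK]] := ck _ _ a.
have [ca ec cU] := cK.
(* Being mono, [a] is the kernel of its cokernel [c]; this is what makes [m] mono below. *)
have [_ _ aU] := (is_kernelP _ _).1 (kernel_of_cokernel ma cK).
pose m := c \oc in1 B Y; pose p := c \oc in2 B Y.
have mpE : m \oc fb = p \oc j.
  apply/eqP; rewrite -subr_eq0 /m /p -!compA -compBr; exact/eqP.
have mf : m \oc f = p \oc d by rewrite fE dE !compA mpE.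
have [q qE] : exists q, e \oc pr2 B Y = q \oc c.
  by apply: cU; rewrite -compA pr2a compNr ej oppr0.
have qm : q \oc m = 0 by rewrite compA -qE -compA pr2_in1 comp0r.
have qp : q \oc p = e by rewrite compA -qE -compA pr2_in2 comp1r.
have joint T (h h' : hom E T) :
    h \oc m = h' \oc m -> h \oc p = h' \oc p -> h = h'.
  by rewrite /m /p !compA => hm hp; apply/ec/dsum_ext.
have mm : mono m.
  apply/mono0 => W h; rewrite -compA => /aU[l hl].
  have l0 : l = 0.
    apply/(mono0 j).1 => //; apply: oppr_inj; rewrite oppr0 -compNl -pr2a.
    by rewrite -compA -hl compA pr2_in1 comp0l.
  by rewrite -[h]comp1l -(pr1_in1 B Y) -compA hl l0 !comp0r.
exists E, m, p, q; split=> //; last first.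
  split=> // T b y byE; have [|t tE] := cU _ (b \oc pr1 B Y + y \oc pr2 B Y).
    rewrite /a compBr !compDl -!compA !(compA (pr1 _ _)) !(compA (pr2 _ _)).
    rewrite pr1_in1 pr2_in1 pr1_in2 pr2_in2 !comp1l !comp0l !comp0r addr0 add0r.
    (* The compatibility of [b] and [y] is given on X; it descends to K by cancelling the
       epimorphism [eX]. *)
    apply: eeX; rewrite comp0l compBl -!compA -fE -dE byE; exact: subrr.
  exists t; rewrite /m /p !compA -tE !compDl -!compA.
  by rewrite pr1_in1 pr2_in1 pr1_in2 pr2_in2 !comp1r !comp0r addr0 add0r.
apply/is_kernelP; split=> //.
(* The mono [m] is the kernel of some [r]. Once [r] is shown to factor through [q], everything
   killed by [q] is killed by [r] and so factors through [m]. *)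
have [R [r /is_kernelP[rm _ rU]]] := mn _ _ _ mm.
move=> W h qh; apply: rU.
have [s sE] : exists s, r \oc p = s \oc e.
  apply: epi_factor => // V v /jU[l ->].
  by rewrite compA -(compA r) -mpE compA rm !comp0l.
have -> : r = s \oc q.
  by apply: joint; rewrite -compA ?qm ?qp // comp0r.
by rewrite -compA qh comp0r.
Qed.

End StandardExtension.

(** * Standard extensions and direct sums of sequences *)

Section StandardSequence.
Variable C : addCat.
Hypothesis abC : abelian C.
Implicit Types X Y Z W B : C.

Definition has_image X Y (d : hom X Y) :=
  exists I (e : hom X I) (i : hom I Y), [/\ d = i \oc e, epi e & mono i].

Lemma exact_has_image X Y Z (f : hom X Y) (g : hom Y Z) :
  exact_at f g -> has_image f.
Proof.
by move=> [K [i [e [/kernel_mono mi fE ee]]]]; exists K, e, i.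
Qed.

Lemma exact_cancel X Y Z Z' (f : hom X Y) (g : hom Y Z) (m : hom Z Z') :
  mono m -> exact_at f (m \oc g) -> exact_at f g.
Proof.
move=> mm [K [i [e [/is_kernelP[gi mi U] fe ee]]]].
exists K, i, e; split=> //; apply/is_kernelP; split=> //.
  by apply/(mono0 m).1 => //; rewrite compA.
by move=> W h gh; apply: U; rewrite -compA gh comp0r.
Qed.

(* The extension with E_i = Q_i for i <= n and E_(n+1) the push-out of
   Q_(n+2) --> Q_(n+1) along the cocycle f. *)
Lemma standard_sequence B n (Q : cplx C) (f : hom (cob Q n.+2) B) :
  acyclic Q -> has_image (cd Q 0) -> f \oc cd Q n.+2 = 0 ->
  exists s : lseq B n.+1 (cob Q 0),
  [/\ lifts (idm _) s f, lexact (projT2 s).1 (projT2 s).2,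
      epi (cd Q 0) -> epi (projT2 s).1,
      forall Y (g : hom (cob Q 0) Y),
        exact_at (cd Q 0) g -> exact_at (projT2 s).1 g &
      forall B' (b : hom B B') X (u : hom (cob Q 0) X) (t : lseq B' n.+1 X),
        lexact (projT2 t).1 (projT2 t).2 -> lifts u t (b \oc f) -> lmor b u s t].
Proof.
elim: n Q f => [|n IH] Q f aQ imD fD.
  (* For n = 0 the push-out is an extension by B of the image I of Q_1 --> Q_0. *)
  have [I [e [i [D0E ee mi]]]] := imD.
  have ex : exact_at (cd Q 1) e.
    by apply: (exact_cancel mi); rewrite -D0E; exact: (aQ 0).
  have [E [m [p [q [mm mq mf qp [joint univ]]]]]] :=
    pushout_extension abC (aQ 1) ex ee fD.
  have eq : epi q by apply: (@epi_compl _ _ _ _ _ p); rewrite qp.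
  exists (existT _ E (i \oc q, m)); split=> /=.
  - by exists p; rewrite comp1l -compA qp D0E.
  - split=> //; apply: exact_post => //.
    by exists B, m, (idm B); split; rewrite ?comp1r //; exact: epi_idm.
  - by move=> eD; apply: epi_comp => //; apply: (@epi_compl _ _ _ _ _ e);
      rewrite -D0E.
  - move=> Y g [K [i2 [e2 [kg D0E2 ee2]]]].
    have [gi2 mi2 U] := (is_kernelP _ _).1 kg.
    have gi : g \oc i = 0.
      by apply: ee; rewrite comp0l -compA -D0E D0E2 compA gi2 comp0l.
    have [l lE] := U _ _ gi; exists K, i2, (l \oc q); split=> //.
      by rewrite compA -lE.
    apply: epi_comp => //; apply: (@epi_compl _ _ _ _ _ e).
    suff -> : l \oc e = e2 by [].
    by apply: mi2; rewrite -D0E2 D0E lE compA.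
  - move=> B' b X u [E' [h t']] /= [mt' ht'] [v [hv t'f]].
    have [r [rm rp]] : exists r, r \oc m = t' \oc b /\ r \oc p = v.
      by apply: univ; rewrite -compA.
    (* Both sides vanish on [m], and both equal [u \oc cd Q 0] on [p]. *)
    exists r; split=> //; apply: joint.
      rewrite -!compA rm mq.1 !comp0r compA (exact_comp ht') comp0l //.
    by rewrite -!compA rp qp -D0E hv.
have aS : acyclic (shift Q) by move=> j; exact: (aQ j.+1).
(* Otherwise Q_1 --> Q_0 is kept and the construction continues on the shifted complex; [gs] carries
   exactness at Q_1 over to the new sequence. *)
have [s [ls xs es gs us]] :=
  IH (shift Q) f aS (exact_has_image (aQ 0)) fD.
exists (existT _ (cob Q 1) (cd Q 0, s)); split=> //=.
- by exists (idm _); rewrite comp1l comp1r.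
- by split=> //; apply: gs; exact: (aQ 0).
move=> B' b X u [E' [h t']] /= [ht' xt'] [v [hv t'f]].
by exists v; split; [rewrite hv | exact: us].
Qed.

(** With [pr1] and [pr2] on the left and identities on the right, the end maps become the identity,
    by [dsum_id], and the diagonal, as [baer_sum] demands. *)
Lemma lmor_dsum_in B0 B1 B2 n (b1 : hom B0 B1) (b2 : hom B0 B2) X0 X1 X2
    (x1 : hom X0 X1) (x2 : hom X0 X2) (e : lseq B0 n X0)
    (s1 : lseq B1 n X1) (s2 : lseq B2 n X2) :
  lmor b1 x1 e s1 -> lmor b2 x2 e s2 ->
  lmor (in1 B1 B2 \oc b1 + in2 B1 B2 \oc b2)
       (in1 X1 X2 \oc x1 + in2 X1 X2 \oc x2) e (lsum s1 s2).
Proof.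
have dmap Y1 Y2 Y1' Y2' Z (f1 : hom Y1 Y1') (f2 : hom Y2 Y2')
    (z1 : hom Z Y1) (z2 : hom Z Y2) :
    dsum_map f1 f2 \oc (in1 Y1 Y2 \oc z1 + in2 Y1 Y2 \oc z2) =
    in1 Y1' Y2' \oc (f1 \oc z1) + in2 Y1' Y2' \oc (f2 \oc z2).
  rewrite /dsum_map compDl !compDr -!compA.
  rewrite !(compA (pr1 _ _)) !(compA (pr2 _ _)).
  rewrite pr1_in1 pr2_in1 pr1_in2 pr2_in2 !comp1l !comp0l !comp0r.
  by rewrite addr0 add0r.
elim: n X0 X1 X2 x1 x2 e s1 s2 => [|n IH] X0 X1 X2 x1 x2 e s1 s2 /=.
  by move=> e1 e2; rewrite dmap -e1 -e2 compDl -!compA.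
move=> [v1 [e1 l1]] [v2 [e2 l2]].
exists (in1 _ _ \oc v1 + in2 _ _ \oc v2); split; last exact: IH.
by rewrite dmap -e1 -e2 compDl -!compA.
Qed.

Lemma lmor_dsum_pr1 B1 B2 n X1 X2 (s1 : lseq B1 n X1) (s2 : lseq B2 n X2) :
  lmor (pr1 B1 B2) (pr1 X1 X2) (lsum s1 s2) s1.
Proof.
have dmap Y1 Y2 Y1' Y2' (f1 : hom Y1 Y1') (f2 : hom Y2 Y2') :
    pr1 Y1' Y2' \oc dsum_map f1 f2 = f1 \oc pr1 Y1 Y2.
  by rewrite compDr !compA pr1_in1 pr1_in2 comp1l !comp0l addr0.
elim: n X1 X2 s1 s2 => [|n IH] X1 X2 s1 s2 /=; first exact: dmap.
by exists (pr1 _ _); split.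
Qed.

Lemma lmor_dsum_pr2 B1 B2 n X1 X2 (s1 : lseq B1 n X1) (s2 : lseq B2 n X2) :
  lmor (pr2 B1 B2) (pr2 X1 X2) (lsum s1 s2) s2.
Proof.
have dmap Y1 Y2 Y1' Y2' (f1 : hom Y1 Y1') (f2 : hom Y2 Y2') :
    pr2 Y1' Y2' \oc dsum_map f1 f2 = f2 \oc pr2 Y1 Y2.
  by rewrite compDr !compA pr2_in1 pr2_in2 comp1l !comp0l add0r.
elim: n X1 X2 s1 s2 => [|n IH] X1 X2 s1 s2 /=; first exact: dmap.
by exists (pr2 _ _); split.
Qed.

End StandardSequence.

(** * Yoneda Ext from a projective resolution *)

Section YonedaDerived.
Variable C : addCat.
Hypothesis abC : abelian C.
Variables (A : C) (P : proj_res A).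
Implicit Types B : C.

(** With A in degree 0, P_j sits in degree j + 1, so lifting the identity of A to an (n+1)-fold
    extension ends with a map from P_(n+1). *)
Definition aug_ob (j : nat) : C := if j is i.+1 then pob P i else A.
Definition aug_diff (j : nat) : hom (aug_ob j.+1) (aug_ob j) :=
  match j return hom (aug_ob j.+1) (aug_ob j) with
  | 0 => paug P
  | i.+1 => pdiff P i
  end.
Definition aug := Cplx aug_diff.

Lemma aug_acyclic : acyclic aug.
Proof. by case=> [|j]; [exact: paug_exact | exact: pdiff_exact]. Qed.

Let saug_acyclic : acyclic (shift aug).
Proof. by move=> j; exact: (aug_acyclic j.+1). Qed.

(* [f] is a cocycle in the cohomology class of the extension [s]. *)
Definition reps B n (s : lseq B n.+1 A) (f : hom (pob P n.+1) B) :=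
  is_ext s /\ @lifts C B n.+1 aug A (idm A) s f.

Lemma reps_exists B n (s : lseq B n.+1 A) : is_ext s -> exists f, reps s f.
Proof.
move=> xs; have [eh ls] := xs.
(* The first component is lifted separately, since at A an extension provides an epimorphism instead
   of exactness at a further map. *)
have [v vE] := @pob_projective _ _ P 0 _ _ _ eh (paug P).
have [|f lf] := @lifts_exists C B n (shift aug) _ _ _ v _ saug_acyclic
  (fun j => @pob_projective _ _ P j.+1) ls.
  by rewrite compA -vE; exact: (acyclic_comp 0 aug_acyclic).
by exists f; split=> //; exists v; rewrite comp1l.
Qed.

Lemma reps_cocycle B n (s : lseq B n.+1 A) f : reps s f -> f \oc pdiff P n.+1 = 0.
Proof.
by move=> [[_ ls] [v [_ lv]]]; exact: (lifts_cocycle saug_acyclic ls lv).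
Qed.

Lemma reps_cobound B n (s : lseq B n.+1 A) f f' :
  reps s f -> reps s f' -> exists w, f - f' = w \oc pdiff P n.
Proof.
move=> [[_ ls] [v [hv lv]]] [_ [v' [hv' lv']]].
have := lifts_sub lv lv'.
apply: (lifts_null saug_acyclic (fun j => @pob_projective _ _ P j) ls).
by rewrite compBr hv hv' subrr.
Qed.

Lemma reps_shift B n (s : lseq B n.+1 A) f w :
  reps s f -> reps s (f + w \oc pdiff P n).
Proof.
move=> [xs [v [hv lv]]]; split=> //; have [_ ls] := xs.
have [a [ha la]] := @lifts_cobound C B n (shift aug) _ _ _ _ w ls.
exists (v + a); split; last exact: lifts_add.
by rewrite compDr hv ha addr0.
Qed.

(** Cocycles are carried forward along a morphism with identity ends. Backwards, any cocycle of [s]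
    is also one of [t], hence differs from [f] by a coboundary, which [reps_shift] absorbs. *)
Lemma reps_step B n (s t : lseq B n.+1 A) f :
  ext_step s t -> reps s f <-> reps t f.
Proof.
move=> [xs xt st].
have fwd g : reps s g -> reps t g.
  move=> [_ lg]; split=> //; have := lifts_lmor st lg.
  by rewrite !comp1l.
split=> [|rf]; first exact: fwd.
have [g rg] := reps_exists xs.
have [w wE] := reps_cobound rf (fwd g rg).
by rewrite -[f](subrK g) addrC wE; exact: reps_shift.
Qed.

Lemma reps_equiv B n (s t : lseq B n.+1 A) f :
  ext_equiv s t -> reps s f <-> reps t f.
Proof.
elim=> [s' t'|s'|s' t' _ IH|s' t' u' _ IH _ IH'] //; first exact: reps_step.
  by split=> /IH.
by split=> [/IH/IH'|/IH'/IH].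
Qed.

Lemma ext_equiv_is_ext B n (s t : lseq B n.+1 A) :
  ext_equiv s t -> is_ext s -> is_ext t.
Proof. by move=> st /reps_exists[f /(reps_equiv _ st)[]]. Qed.

(** The mapping property produces all the morphisms of extensions used below: a morphism out of [s]
    exists as soon as the cocycles match. *)
Lemma standard_extension B n (f : hom (pob P n.+1) B) :
  f \oc pdiff P n.+1 = 0 ->
  exists s : lseq B n.+1 A, reps s f /\
    forall B' (b : hom B B') (t : lseq B' n.+1 A),
      reps t (b \oc f) -> lmor b (idm A) s t.
Proof.
(* The augmentation is epi, so its image is A itself. *)
move=> fd; have im0 : has_image (cd aug 0).
  exists A, (paug P), (idm A); rewrite comp1l; split=> //.
    exact: paug_epi.
  by move=> W h h'; rewrite !comp1l.
have [s [ls xs es _ us]] := standard_sequence abC aug_acyclic im0 fd.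
exists s; split; first by split=> //; split=> //; apply/es/paug_epi.
by move=> B' b t [[_ lt] lf]; apply: us.
Qed.

(** Both extensions receive a morphism from the standard extension of [f]. *)
Lemma reps_inj B n (s t : lseq B n.+1 A) f : reps s f -> reps t f -> ext_equiv s t.
Proof.
move=> rs rt; have [u [ru uU]] := standard_extension (reps_cocycle rs).
have to v : reps v f -> ext_equiv u v.
  move=> rv; apply: rst_step; split; [exact: ru.1 | exact: rv.1 |].
  by apply: uU; rewrite comp1l.
by apply: rst_trans (to _ rt); apply: rst_sym; exact: to.
Qed.

(** A cocycle of the middle extension [e] takes values in B (+) B; its two components are cocycles
    of [s1] and [s2], and its image under the codiagonal is one of [s3]. *)
Lemma baer_sum_reps B n (s1 s2 s3 : lseq B n.+1 A) :
  is_ext s1 -> is_ext s2 -> is_ext s3 -> baer_sum s1 s2 s3 ->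
  exists f1 f2, [/\ reps s1 f1, reps s2 f2 & reps s3 (f1 + f2)].
Proof.
move=> x1 x2 x3 [e [xe l12 l3]]; have [f [_ lf]] := reps_exists xe.
exists (pr1 _ _ \oc f), (pr2 _ _ \oc f).
have := lifts_lmor l12 lf; rewrite comp1l comp1r => lsf.
split; split=> //.
- have := lifts_lmor (lmor_dsum_pr1 s1 s2) lsf.
  by rewrite compDr pr1_in1 pr1_in2 addr0.
- have := lifts_lmor (lmor_dsum_pr2 s1 s2) lsf.
  by rewrite compDr pr2_in1 pr2_in2 add0r.
- by have := lifts_lmor l3 lf; rewrite comp1l compDl.
Qed.

(** The middle extension is the standard one of the pair (f1, f2); its mapping property for the
    projections and the codiagonal gives the morphisms required. *)
Lemma reps_baer_sum B n (f1 f2 : hom (pob P n.+1) B) :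
  f1 \oc pdiff P n.+1 = 0 -> f2 \oc pdiff P n.+1 = 0 ->
  exists s1 s2 s3 : lseq B n.+1 A,
    [/\ reps s1 f1, reps s2 f2, reps s3 (f1 + f2) & baer_sum s1 s2 s3].
Proof.
move=> d1 d2; pose f := in1 B B \oc f1 + in2 B B \oc f2.
have [|e [re eU]] := @standard_extension _ n f.
  by rewrite compDl -!compA d1 d2 !comp0r addr0.
have [|s3 [r3 _]] := @standard_extension _ n (f1 + f2).
  by rewrite compDl d1 d2 addr0.
have [s1 [r1 _]] := standard_extension d1.
have [s2 [r2 _]] := standard_extension d2.
have p1 : pr1 B B \oc f = f1.
  by rewrite compDr !compA pr1_in1 pr1_in2 comp1l comp0l addr0.
have p2 : pr2 B B \oc f = f2.
  by rewrite compDr !compA pr2_in1 pr2_in2 comp1l comp0l add0r.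
exists s1, s2, s3; split=> //; exists e; split; first exact: re.1.
- have l1 : lmor (pr1 B B) (idm A) e s1 by apply: eU; rewrite p1.
  have l2 : lmor (pr2 B B) (idm A) e s2 by apply: eU; rewrite p2.
  by have := lmor_dsum_in l1 l2; rewrite dsum_id !comp1r.
- by apply: eU; rewrite compDl p1 p2.
Qed.

Section Comparison.
Variables (B : C) (i : nat) (G : zmodType) (cl : hom (pob P i) B -> G).
Hypothesis clD : forall f g, f \oc pdiff P i = 0 -> g \oc pdiff P i = 0 ->
  cl (f + g) = cl f + cl g.
Hypothesis cl_ker : forall f, f \oc pdiff P i = 0 -> cl f = 0 <-> is_cobound f.
Hypothesis cl_surj : forall y, exists f, f \oc pdiff P i = 0 /\ cl f = y.

Lemma class_eq f g : f \oc pdiff P i = 0 -> g \oc pdiff P i = 0 ->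
  cl f = cl g <-> is_cobound (f - g).
Proof.
move=> df dg; have dfg : (f - g) \oc pdiff P i = 0 by rewrite compBl df dg subrr.
rewrite -(cl_ker dfg) -{1}[f](subrK g) clD //.
by split=> [/eqP|->]; rewrite ?add0r // -[X in _ == X]add0r => /eqP/addIr.
Qed.

End Comparison.

Lemma bijective_of (T U : Type) (h : T -> U) :
  injective h -> (forall y, exists x, h x = y) -> bijective h.
Proof.
move=> hi /choice[g gK]; exists g => // x; exact/hi/gK.
Qed.

(** The map [cl] presents G as cocycles modulo coboundaries. Keeping G abstract allows it to be a
    cohomology group computed in an equivalent category. *)
Theorem yoneda_ext_derived B i (G : zmodType) (cl : hom (pob P i) B -> G) :
  (forall f g, f \oc pdiff P i = 0 -> g \oc pdiff P i = 0 ->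
     cl (f + g) = cl f + cl g) ->
  (forall f, f \oc pdiff P i = 0 -> cl f = 0 <-> is_cobound f) ->
  (forall y, exists f, f \oc pdiff P i = 0 /\ cl f = y) ->
  yext_iso i A B G.
Proof.
case: i cl => [|n] cl clD cl0 clS; have clE := class_eq clD cl0.
  have pd : paug P \oc pdiff P 0 = 0 := exact_comp (paug_exact P).
  have apd (a : hom A B) : a \oc paug P \oc pdiff P 0 = 0.
    by rewrite -compA pd comp0r.
  exists (fun a => cl (a \oc paug P)).
  have hi : injective (fun a : yext 0 A B => cl (a \oc paug P)).
    move=> a b /clE-/(_ (apd a) (apd b))/= /eqP; rewrite subr_eq0 => /eqP.
    exact: paug_epi.
  have hD (x y : hom A B) :
      cl ((x + y) \oc paug P) = cl (x \oc paug P) + cl (y \oc paug P).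
    by rewrite compDl clD.
  split; last by move=> x y z /=; rewrite -hD; split=> [->|/hi].
  apply: bijective_of => // y; have [f [fd <-]] := clS y.
  have [a aE] : exists a, f = a \oc paug P; last by exists a; rewrite /= -aE.
  (* A 0-cocycle vanishes on the image of P_1, which is the kernel of the augmentation. *)
  apply: (epi_factor abC); first exact: paug_epi.
  move=> W r; have [K [j [e [/is_kernelP[_ _ U] dE ee]]]] := paug_exact P.
  move=> /U[l ->]; rewrite compA; suff -> : f \oc j = 0 by rewrite comp0l.
  by apply: ee; rewrite comp0l -compA -dE.
have ex (x : yext n.+1 A B) : exists f, exists2 s, proj1_sig x s & reps s f.
  case: x => c [s [xs cE]]; have [f rf] := reps_exists xs.
  by exists f, s => //=; apply/cE/rst_refl.
have [rep repP] := choice ex.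
have reps_cl s f g : reps s f -> g \oc pdiff P n.+1 = 0 -> cl f = cl g ->
    reps s g.
  move=> rf dg /esym/(clE _ _ dg (reps_cocycle rf))[w wE].
  by rewrite -[g](subrK f) addrC wE; exact: reps_shift.
have cl_reps s f g : reps s f -> reps s g -> cl f = cl g.
  move=> rf rg; apply/clE; [exact: reps_cocycle rf|exact: reps_cocycle rg|].
  exact: reps_cobound rf rg.
have memE (x : yext n.+1 A B) s t : proj1_sig x s -> 
    proj1_sig x t <-> ext_equiv s t.
  case: x => c [u [_ cE]] /= /cE us; rewrite cE.
  by split=> ?; [apply: rst_trans (rst_sym _ _ _ _ us) _ | apply: rst_trans us _].
(* The choice of [rep x] does not matter: all members of a class have the same cocycles, up to
   coboundaries ([hE]). Conversely [h x] determines the members of x ([mem_cl]). *)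
pose h x := cl (rep x).
have hE (x : yext n.+1 A B) s f : proj1_sig x s -> reps s f -> h x = cl f.
  move=> xs rf; have [t xt rt] := repP x.
  by apply: (@cl_reps s) => //; apply/(reps_equiv _ ((memE _ _ _ xs).1 xt)).
have mem_cl (x : yext n.+1 A B) s f : reps s f -> h x = cl f -> proj1_sig x s.
  move=> rf hx; have [t xt rt] := repP x.
  apply/(memE _ _ _ xt)/(reps_inj _ rf).
  exact: reps_cl rt (reps_cocycle rf) hx.
have mem_ext (x : yext n.+1 A B) s : proj1_sig x s -> is_ext s.
  move=> xs; have [t xt [et _]] := repP x.
  exact: ext_equiv_is_ext ((memE _ _ _ xt).1 xs) et.
exists h; split; first apply: bijective_of.
- move=> x y hxy.
  have E s : proj1_sig x s <-> proj1_sig y s.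
    split=> ms; have [f rf] := reps_exists (mem_ext _ _ ms);
      by apply: (mem_cl _ s f) => //; rewrite -(hE _ _ _ ms rf).
  case: x y E {hxy} => [c1 H1] [c2 H2] /= E.
  have c12 : c1 = c2 by apply/funext => s; apply/propext.
  by subst c2; congr exist; exact: Prop_irrelevance.
- move=> y; have [f [fd <-]] := clS y.
  have [s [rs _]] := standard_extension fd.
  pose x : yext n.+1 A B := exist _ (fun t => ext_equiv s t)
    (ex_intro _ s (conj rs.1 (fun t => iff_refl _))).
  by exists x; apply: (hE x s) => //; exact: rst_refl.
move=> x y z; split=> [[s1 [s2 [s3 [m1 m2 m3 b]]]]|hz].
  have [] := baer_sum_reps _ _ _ b; [exact: mem_ext m1|exact: mem_ext m2|
    exact: mem_ext m3|] => f1 [f2 [r1 r2 r3]].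
  rewrite (hE _ _ _ m1 r1) (hE _ _ _ m2 r2) (hE _ _ _ m3 r3).
  by rewrite clD //; [exact: reps_cocycle r1|exact: reps_cocycle r2].
(* Any cocycles of x and y are realized by extensions with a Baer sum; by their values under [cl],
   these three extensions lie in x, y and z. *)
have [[t1 _ rt1] [t2 _ rt2]] := (repP x, repP y).
have [d1 d2] := (reps_cocycle rt1, reps_cocycle rt2).
have [s1 [s2 [s3 [r1 r2 r3 b]]]] := reps_baer_sum d1 d2.
exists s1, s2, s3; split=> //.
- exact: mem_cl r1 _.
- exact: mem_cl r2 _.
- by apply: mem_cl r3 _; rewrite clD.
Qed.

End YonedaDerived.

(** * Equivalences *)

Section Equivalences.

Definition is_additive (C D : addCat) (F : functor C D) :=
  forall (X Y : C) (f g : hom X Y), fmap F (f + g) = fmap F f + fmap F g.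

Lemma nat_iso_sym (C D : addCat) (F G : functor C D) : nat_iso F G -> nat_iso G F.
Proof.
move=> [eta [theta [te et nt]]]; exists theta, eta; split=> // X Y f.
by rewrite -[LHS]comp1r -(et X) compA -(compA (theta Y)) -nt compA te comp1l.
Qed.

Lemma equivalence_inverse (C D : addCat) (F : functor C D) :
  is_equivalence F -> exists G, is_equivalence G /\
    nat_iso (comp_functor F G) (id_functor D) /\
    nat_iso (comp_functor G F) (id_functor C).
Proof. by move=> [G [GF FG]]; exists G; split=> //; exists F. Qed.

Lemma equivalence_faithful (C D : addCat) (F : functor C D) (X Y : C)
    (f g : hom X Y) : is_equivalence F -> fmap F f = fmap F g -> f = g.
Proof.
move=> [G [[eta [theta [te et nt]]] _]] Ffg.
rewrite -[f]comp1r -[g]comp1r -(et X) !compA.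
by rewrite -[f]/(fmap (id_functor C) f) -[g]/(fmap (id_functor C) g) -!nt /= Ffg.
Qed.

(** The preimage is [fmap G h] conjugated by the isomorphism of G F with the identity; that F maps
    it to [h] is checked after applying the faithful functor G. *)
Lemma equivalence_full (C D : addCat) (F : functor C D) (X Y : C)
    (h : hom (F X) (F Y)) : is_equivalence F -> exists f, fmap F f = h.
Proof.
move=> eF; have [G [[eta [theta [te et nt]]] FG]] := eF.
have eG : is_equivalence G.
  by exists F; split=> //; exists eta, theta.
exists (eta Y \oc fmap G h \oc theta X); apply: (equivalence_faithful eG).
set f := (X in fmap F X).
have nf : eta Y \oc fmap G (fmap F f) = f \oc eta X := nt _ _ f.
rewrite -[LHS]comp1l -[RHS]comp1l -(te Y) -!compA nf /f.
by rewrite -!compA te comp1r.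
Qed.

Lemma split_epi (C : addCat) (X Y : C) (f : hom X Y) (g : hom Y X) :
  f \oc g = idm Y -> epi f.
Proof. by move=> fg; apply: (@epi_compl _ _ _ _ _ g); rewrite fg; exact: epi_idm. Qed.

Lemma split_mono (C : addCat) (X Y : C) (f : hom X Y) (g : hom Y X) :
  f \oc g = idm Y -> mono g.
Proof.
move=> fg; apply: (@mono_compr _ _ _ _ f); rewrite fg => W h h'.
by rewrite !comp1l.
Qed.

(** * Properties preserved and reflected by an equivalence *)

Section Preservation.
Variables (C D : addCat) (F : functor C D).
Hypotheses (eF : is_equivalence F) (aF : is_additive F).

Lemma fmap0 (X Y : C) : fmap F (0 : hom X Y) = 0.
Proof. by apply: (addrI (fmap F 0)); rewrite -aF !addr0. Qed.

Lemma fmap_eq0 (X Y : C) (f : hom X Y) : fmap F f = 0 -> f = 0.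
Proof. by rewrite -(fmap0 X Y); exact: equivalence_faithful. Qed.

Lemma equivalence_esurj (Y : D) :
  exists (X : C) (u : hom (F X) Y) (v : hom Y (F X)),
    u \oc v = idm Y /\ v \oc u = idm (F X).
Proof.
have [G [_ [eta [theta [te et _]]]]] := eF; exists (G Y), (eta Y), (theta Y).
by split; [exact: et | exact: te].
Qed.

Lemma fmap_full (X Y : C) (h : hom (F X) (F Y)) : exists f, fmap F f = h.
Proof. exact: equivalence_full. Qed.

(** Reduces tests on arbitrary objects of D to tests on objects of the form F W', by replacing W
    with an isomorphic object. *)
Lemma lift_dom (W : D) (X : C) (h : hom W (F X)) :
  exists W' (v : hom W (F W')) (u : hom (F W') W) (f : hom W' X),
  [/\ h = fmap F f \oc v, fmap F f = h \oc u, u \oc v = idm W &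
      v \oc u = idm (F W')].
Proof.
have [W' [u [v [uv vu]]]] := equivalence_esurj W.
have [f fE] := fmap_full (h \oc u).
by exists W', v, u, f; split; rewrite ?fE -?compA ?uv ?comp1r.
Qed.

Lemma lift_cod (X : C) (W : D) (h : hom (F X) W) :
  exists W' (u : hom (F W') W) (v : hom W (F W')) (f : hom X W'),
  [/\ h = u \oc fmap F f, fmap F f = v \oc h, u \oc v = idm W &
      v \oc u = idm (F W')].
Proof.
have [W' [u [v [uv vu]]]] := equivalence_esurj W.
have [f fE] := fmap_full (v \oc h).
by exists W', u, v, f; split; rewrite ?fE ?compA ?uv ?comp1l.
Qed.

Lemma fmap_mono (X Y : C) (f : hom X Y) : mono f -> mono (fmap F f).
Proof.
move=> /mono0 mf; apply/mono0 => W h fh.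
have [W' [v [u [g [hE gE _ _]]]]] := lift_dom h.
suff g0 : g = 0 by rewrite hE g0 fmap0 comp0l.
by apply/mf/fmap_eq0; rewrite fmap_comp gE compA fh comp0l.
Qed.

Lemma fmap_epi (X Y : C) (f : hom X Y) : epi f -> epi (fmap F f).
Proof.
move=> /epi0 mf; apply/epi0 => W h fh.
have [W' [u [v [g [hE gE _ _]]]]] := lift_cod h.
suff g0 : g = 0 by rewrite hE g0 fmap0 comp0r.
by apply/mf/fmap_eq0; rewrite fmap_comp gE -compA fh comp0r.
Qed.

Lemma fmap_kernel (K Y Z : C) (g : hom Y Z) (i : hom K Y) :
  is_kernel g i -> is_kernel (fmap F g) (fmap F i).
Proof.
move=> /is_kernelP[gi mi U]; apply/is_kernelP.
split; [by rewrite -fmap_comp gi fmap0 | exact: fmap_mono |].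
move=> W h; have [W' [v [u [f [-> _ _ vu]]]]] := lift_dom h => gfv.
have [|l ->] := U _ f; last by exists (fmap F l \oc v); rewrite fmap_comp compA.
apply: fmap_eq0; rewrite fmap_comp -[LHS]comp1r -vu compA -(compA _ _ v).
by rewrite gfv comp0l.
Qed.

Lemma fmap_exact (X Y Z : C) (f : hom X Y) (g : hom Y Z) :
  exact_at f g -> exact_at (fmap F f) (fmap F g).
Proof.
move=> [K [i [e [ki -> ee]]]]; exists (F K), (fmap F i), (fmap F e).
by split; [exact: fmap_kernel | rewrite fmap_comp | exact: fmap_epi].
Qed.

Lemma equivalence_exact : is_exact F.
Proof.
split=> // X Y Z f g [mf ex eg].
by split; [exact: fmap_mono | exact: fmap_exact | exact: fmap_epi].
Qed.

Lemma fmap_epi_reflect (X Y : C) (f : hom X Y) : epi (fmap F f) -> epi f.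
Proof.
move=> /epi0 ef; apply/epi0 => W h hf; apply/fmap_eq0/ef.
by rewrite -fmap_comp hf fmap0.
Qed.

Lemma fmap_mono_reflect (X Y : C) (f : hom X Y) : mono (fmap F f) -> mono f.
Proof.
move=> /mono0 ef; apply/mono0 => W h hf; apply/fmap_eq0/ef.
by rewrite -fmap_comp hf fmap0.
Qed.

Lemma fmap_kernel_reflect (K Y Z : C) (g : hom Y Z) (i : hom K Y) :
  is_kernel (fmap F g) (fmap F i) -> is_kernel g i.
Proof.
move=> /is_kernelP[gi mi U]; apply/is_kernelP; split.
- by apply: fmap_eq0; rewrite fmap_comp.
- exact: fmap_mono_reflect.
move=> W h gh; have [|l lE] := U _ (fmap F h).
  by rewrite -fmap_comp gh fmap0.
have [l' l'E] := fmap_full l; exists l'.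
by apply: (equivalence_faithful eF); rewrite fmap_comp l'E.
Qed.

Lemma fmap_cokernel_reflect (Y Z Q : C) (g : hom Y Z) (p : hom Z Q) :
  is_cokernel (fmap F g) (fmap F p) -> is_cokernel g p.
Proof.
move=> [pg ep U]; split.
- by apply: fmap_eq0; rewrite fmap_comp.
- exact: fmap_epi_reflect.
move=> W h gh; have [|l lE] := U _ (fmap F h).
  by rewrite -fmap_comp gh fmap0.
have [l' l'E] := fmap_full l; exists l'.
by apply: (equivalence_faithful eF); rewrite fmap_comp l'E.
Qed.

(** The lifting problem is conjugated by isomorphisms of Y and Z with F Y' and F Z', solved in C,
    and mapped back. *)
Lemma fmap_projective (X : C) : projective X -> projective (F X).
Proof.
move=> pX Y Z e ee f.
have [Z' [u [v [uv vu]]]] := equivalence_esurj Z.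
have [Y' [u' [v' [uv' vu']]]] := equivalence_esurj Y.
have [e' e'E] := fmap_full (v \oc e \oc u').
have [f' f'E] := fmap_full (v \oc f).
have ee' : epi e'.
  apply: fmap_epi_reflect; rewrite e'E.
  apply: epi_comp (split_epi uv'); apply: epi_comp => //.
  exact: split_epi vu.
have [g gE] := pX _ _ _ ee' f'; exists (u' \oc fmap F g).
have : v \oc f = v \oc (e \oc (u' \oc fmap F g)).
  by rewrite -f'E gE fmap_comp e'E -!compA.
by move/(congr1 (fun k => u \oc k)); rewrite !compA uv !comp1l.
Qed.

Lemma fmap_injective (X : C) : injective_ob X -> injective_ob (F X).
Proof.
move=> pX Y Z m mm f.
have [Z' [u [v [uv vu]]]] := equivalence_esurj Z.
have [Y' [u' [v' [uv' vu']]]] := equivalence_esurj Y.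
have [m' m'E] := fmap_full (v \oc m \oc u').
have [f' f'E] := fmap_full (f \oc u').
have mm' : mono m'.
  apply: fmap_mono_reflect; rewrite m'E.
  apply: mono_comp (split_mono vu'); apply: mono_comp => //.
  exact: split_mono uv.
have [g gE] := pX _ _ _ mm' f'; exists (fmap F g \oc v).
have : f \oc u' = fmap F g \oc v \oc m \oc u'.
  by rewrite -f'E gE fmap_comp m'E -!compA.
by move/(congr1 (fun k => k \oc v')); rewrite -!compA uv' !comp1r.
Qed.

(** Each kernel or cokernel is taken in D, moved by an isomorphism to the image of F, and reflected
    to C. *)
Lemma abelian_equivalence : abelian D -> abelian C.
Proof.
move=> [kD cD mD eD]; split.
- move=> Y Z g; have [K [i /is_kernelP[gi mi U]]] := kD _ _ (fmap F g).
  have [K' [v [u [f [iE fE _ vu]]]]] := lift_dom i.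
  exists K', f; apply/fmap_kernel_reflect/is_kernelP; split.
  + by rewrite fE compA gi comp0l.
  + by rewrite fE; apply: mono_comp => //; exact: split_mono vu.
  + by move=> W h /U[l ->]; exists (v \oc l); rewrite compA -iE.
- move=> Y Z g; have [Q [p [pg ep U]]] := cD _ _ (fmap F g).
  have [Q' [u [v [f [pE fE _ vu]]]]] := lift_cod p.
  exists Q', f; apply: fmap_cokernel_reflect; split.
  + by rewrite fE -compA pg comp0r.
  + by rewrite fE; apply: epi_comp => //; exact: split_epi vu.
  + by move=> W h /U[l ->]; exists (l \oc u); rewrite -compA -pE.
- move=> X Y f /fmap_mono/mD[Z [g /is_kernelP[gf mf U]]].
  have [Z' [u [v [g' [gE g'E uv _]]]]] := lift_cod g.
  exists Z', g'; apply/fmap_kernel_reflect/is_kernelP; split=> //.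
  + by rewrite g'E -compA gf comp0r.
  + by move=> W h g'h; apply: U; rewrite gE -compA g'h comp0r.
- move=> X Y f /fmap_epi/eD[W [g [fg ef U]]].
  have [W' [v [u [g' [gE g'E _ _]]]]] := lift_dom g.
  exists W', g'; apply: fmap_cokernel_reflect; split=> //.
  + by rewrite g'E compA fg comp0l.
  + by move=> V h hg'; apply: U; rewrite gE compA hg' comp0l.
Qed.

End Preservation.

(** F G h is a conjugate of h, hence additive in h, and F is additive and faithful. *)
Lemma inverse_additive (C D : addCat) (F : functor C D) (G : functor D C) :
  is_equivalence F -> is_additive F ->
  nat_iso (comp_functor F G) (id_functor D) -> is_additive G.
Proof.
move=> eF aF [eta [theta [te et nt]]] X Y f g.
have FG (h : hom X Y) : fmap F (fmap G h) = theta Y \oc h \oc eta X.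
  have nh : eta Y \oc fmap F (fmap G h) = h \oc eta X := nt _ _ h.
  by rewrite -compA -nh compA te comp1l.
by apply: (equivalence_faithful eF); rewrite aF !FG compDr compDl.
Qed.

End Equivalences.

(** * Ext along an additive equivalence *)

Section ExtTransport.
Variables (C D : addCat) (F : functor C D).
Hypotheses (eF : is_equivalence F) (aF : is_additive F).

Section Resolution.
Variables (G : functor D C) (M : D) (V : C) (eps : hom (G M) V) (P : proj_res M).
Hypotheses (eG : is_equivalence G) (aG : is_additive G).
Hypotheses (meps : mono eps) (eeps : epi eps).

(** In the application M is F V, and G (F V) is only isomorphic to V; [eps] is that isomorphism and
    corrects the augmentation. *)
Definition proj_res_image : proj_res V.
Proof.
refine (@ProjRes C V (fun i => G (pob P i)) (fun i => fmap G (pdiff P i))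
  (eps \oc fmap G (paug P)) _ _ _ _).
- by move=> i; apply: (fmap_projective eG aG); exact: pob_projective.
- by apply: epi_comp => //; apply: (fmap_epi eG aG); exact: paug_epi.
- by apply: exact_post => //; apply: (fmap_exact eG aG); exact: paug_exact.
- by move=> i; apply: (fmap_exact eG aG); exact: pdiff_exact.
Defined.

End Resolution.

Lemma homology_eq0 (X N : D) (P : proj_res X) i (f : cocycle N P i) :
  (\pi_(homology N P i) f = 0) <-> is_cobound (val f).
Proof.
have E : (\pi_(homology N P i) f == 0) = (f \in @cobound_pred _ _ N P i).
  rewrite -[X in _ == X](raddf0 (\pi_(Quotient.quot (@cobound_pred _ _ N P i)))).
  by rewrite -Quotient.idealrBE subr0.
split=> [/eqP|/cobound_predP fc]; first by rewrite E => /cobound_predP.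
by apply/eqP; rewrite E.
Qed.

Theorem yext_iso_homology (V W : C) (P : proj_res (F V)) (i : nat) :
  abelian D -> yext_iso i V W (homology (F W) P i).
Proof.
move=> abD; have [G [eG [FG GF]]] := equivalence_inverse eF.
have aG := inverse_additive eF aF FG.
have [eta [eta' [e'e ee' _]]] := GF.
have [th [th' [tt' t't tn]]] := nat_iso_sym FG.
have {}tn X Y (d : hom X Y) : th Y \oc d = fmap F (fmap G d) \oc th X by exact: tn.
have {}tt' X : th' X \oc th X = idm X by exact: tt'.
have {}t't X : th X \oc th' X = idm (F (G X)) by exact: t't.
have meta : mono (eta V) by apply: (@split_mono _ _ _ (eta' V)).
have eeta : epi (eta V) by apply: (@split_epi _ _ _ _ (eta' V)).
pose Q : proj_res V := proj_res_image P eG aG meta eeta.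
(* The adjunction bijection from Hom(G P_j, W) to Hom(P_j, F W); it is additive and commutes with
   the differentials. *)
pose t j (f : hom (pob Q j) W) : hom (pob P j) (F W) := fmap F f \oc th (pob P j).
have tD j (f g : hom (pob Q j) W) : t j (f + g) = t j f + t j g.
  by rewrite /t aF compDl.
have t0 j : t j 0 = 0 by rewrite /t fmap0 // comp0l.
have t_inj j : injective (t j).
  move=> f g /(congr1 (fun h => h \oc th' _)).
  by rewrite /t -!compA t't !comp1r; exact: (equivalence_faithful eF).
have t_surj j h : exists f, t j f = h.
  have [f fE] := @equivalence_full _ _ F (G (pob P j)) W (h \oc th' _) eF; exists f.
  by rewrite /t fE -compA tt' comp1r.
have td j f : t j.+1 (f \oc pdiff Q j) = t j f \oc pdiff P j.
  by rewrite /t fmap_comp -!compA tn.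
have tcoc f : f \oc pdiff Q i = 0 -> t i f \in @cocycle_pred _ _ (F W) P i.
  by move=> fd; rewrite inE -td fd t0.
have tcob f : is_cobound f <-> is_cobound (t i f).
  case: i f {tcoc} => [|j] f /=.
    by split=> [->|]; [exact: t0 | rewrite -(t0 0%N) => /t_inj].
  split=> [[g ->]|[h]]; first by exists (t j g); rewrite td.
  by have [g <-] := t_surj _ h; rewrite -td => /t_inj ->; exists g.
(* Off the cocycles [insubd] returns the default 0; the conditions on [cl] only concern cocycles. *)
pose coc f : cocycle (F W) P i := insubd 0 (t i f).
have cocE f : f \oc pdiff Q i = 0 -> val (coc f) = t i f.
  by move=> /tcoc fd; rewrite /coc insubdK.
apply: (@yoneda_ext_derived _ (abelian_equivalence eF aF abD) _ Q W i _
  (fun f => \pi_(homology (F W) P i) (coc f))).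
- move=> f g df dg; rewrite -raddfD; congr (\pi _).
  by apply: val_inj; rewrite /= !cocE ?tD // compDl df dg addr0.
- by move=> f df; rewrite homology_eq0 tcob cocE.
- move=> y; have [f fE] := t_surj i (val (repr y)).
  have fd : f \oc pdiff Q i = 0.
    apply: t_inj; rewrite td t0 fE; apply/eqP; exact: (valP (repr y)).
  exists f; split=> //; rewrite -[RHS]reprK; congr (\pi _).
  by apply: val_inj; rewrite cocE.
Qed.

End ExtTransport.

(** * Modules form an abelian category *)

Section ModAbelian.
Variable R : pzRingType.

Lemma mod_elt_subproof (M : lmodType R) (x : M) : linear (fun a : R^o => (a : R) *: x).
Proof. by move=> a b c; rewrite scalerDl scalerA. Qed.

(** Elements of M are maps from R to M, so categorical conditions can be tested on elements. *)
Definition mod_elt (M : lmodType R) (x : M) : lhom (R^o : lmodType R) M :=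
  mk_lhom (mod_elt_subproof x).

Lemma mod_eltK (M : lmodType R) (x : M) : val (mod_elt x) 1 = x.
Proof. exact: scale1r. Qed.

Lemma lhomB (M N : lmodType R) (f : lhom M N) x y : val f (x - y) = val f x - val f y.
Proof. by rewrite addrC -scaleN1r (lhomP f) scaleN1r addrC. Qed.

Lemma comp_mod_elt (M N : lmodType R) (f : lhom M N) x :
  val f x = 0 -> @comp (Mod R) _ _ _ f (mod_elt x) = 0.
Proof.
move=> fx; apply: lhom_eq => a /=; have := lhomP f a x 0.
by rewrite lhom0 !addr0 fx scaler0.
Qed.

Lemma Mod_mono_inj (M N : Mod R) (f : hom M N) : mono f -> injective (val f).
Proof.
move=> /mono0 mf x y fxy; apply/eqP; rewrite -subr_eq0 -[X in X == _]mod_eltK.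
by rewrite (mf _ (mod_elt (x - y))) //; apply: comp_mod_elt; rewrite lhomB fxy subrr.
Qed.

Lemma Mod_kernel_elt (K M N : Mod R) (f : hom M N) (i : hom K M) x :
  is_kernel f i -> val f x = 0 -> exists y, val i y = x.
Proof.
move=> /is_kernelP[_ _ U] /comp_mod_elt/U[l lE]; exists (val l 1).
by rewrite -[RHS]mod_eltK lE.
Qed.

(** Factorizations are defined through chosen preimages. Linearity and commutation hold because the
    value is independent of the choice or, for monomorphisms, the preimage is unique. *)
Lemma Mod_abelian : abelian (Mod R).
Proof.
have pi0 (M N : lmodType R) (f : lhom M N) y :
    coker_pi f y = 0 <-> exists x, val f x = y.
  have E : (coker_pi f y == 0) = (y \in im_pred f).
    rewrite -[X in _ == X](raddf0 (\pi_(Quotient.quot (im_pred f)))).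
    by rewrite -Quotient.idealrBE subr0.
  split=> [/eqP|/im_predP yf]; first by rewrite E => /im_predP.
  by apply/eqP; rewrite E.
split.
- exact: Mod_kernel.
- move=> M N f; exists (coker f : lmodType R), (mk_lhom (coker_pi_linear f)).
  split.
  + by apply: lhom_eq => x; apply/pi0; exists x.
  + by apply/epi_surj => y; exists (repr y); exact: coker_repr.
  + move=> P h /(congr1 val) hf.
    have hpi y y' : coker_pi f y = coker_pi f y' -> val h y = val h y'.
      move=> yy'; apply/eqP; rewrite -subr_eq0 -lhomB; apply/eqP.
      have [|x <-] := (pi0 _ _ f (y - y')).1; last exact: (congr1 (@^~ x) hf).
      by rewrite /coker_pi raddfB; apply/eqP; rewrite subr_eq0; apply/eqP.
    have lh : linear (fun q : coker f => val h (repr q)).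
      move=> a p q; rewrite -lhomP; apply: hpi.
      by rewrite coker_pi_linear !coker_repr.
    exists (mk_lhom lh); apply: lhom_eq => y /=.
    by apply: hpi; rewrite coker_repr.
- move=> M N f mf; have fi := Mod_mono_inj mf.
  exists (coker f : lmodType R), (mk_lhom (coker_pi_linear f)).
  apply/is_kernelP; split=> //.
    by apply: lhom_eq => x; apply/pi0; exists x.
  move=> W h /(congr1 val) ph.
  have /choice[l lE] w : exists x, val f x = val h w.
    by apply/pi0; exact: (congr1 (@^~ w) ph).
  have ll : linear l by move=> a x y; apply: fi; rewrite lhomP !lE lhomP.
  by exists (mk_lhom ll); apply: lhom_eq => w; rewrite /= lE.
- move=> M N f ef; have fs := (epi_surj f).1 ef.
  have [K [i ki]] := Mod_kernel f.
  exists K, i; have [fi mi U] := (is_kernelP _ _).1 ki.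
  split=> // P h /(congr1 val) hi.
  have hf x x' : val f x = val f x' -> val h x = val h x'.
    move=> xx'; apply/eqP; rewrite -subr_eq0 -lhomB; apply/eqP.
    have [|y <-] := @Mod_kernel_elt _ _ _ _ _ (x - x') ki.
      by rewrite lhomB xx' subrr.
    exact: (congr1 (@^~ y) hi).
  have [g gK] := choice fs.
  have ll : linear (fun y => val h (g y)).
    by move=> a x y; rewrite -lhomP; apply: hf; rewrite gK lhomP !gK.
  by exists (mk_lhom ll); apply: lhom_eq => x /=; apply: hf; rewrite gK.
Qed.

End ModAbelian.

(** * Connections as modules *)

Section EndomorphismRing.
Variables (R : comPzRingType) (M : lmodType R).

(** This ring is used over k, on [rest_lmod phi E]: the operators of a connection are k-linear but
    in general not A-linear. *)
Definition lend : Type := lhom M M.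
HB.instance Definition _ := GRing.Zmodule.on lend.

Definition lend_mul (f g : lend) : lend := mk_lhom (lcomp_subproof f g).
Definition lend_one : lend := @mk_lhom _ M M id (fun a x y => erefl).

Lemma lend_mulA : associative lend_mul.
Proof. by move=> f g h; apply: lhom_eq. Qed.
Lemma lend_mul1l : left_id lend_one lend_mul.
Proof. by move=> f; apply: lhom_eq. Qed.
Lemma lend_mul1r : right_id lend_one lend_mul.
Proof. by move=> f; apply: lhom_eq. Qed.
Lemma lend_mulDl : left_distributive lend_mul +%R.
Proof. by move=> f g h; apply: lhom_eq. Qed.
Lemma lend_mulDr : right_distributive lend_mul +%R.
Proof.
move=> f g h; apply: lhom_eq => x /=.
by have := lhomP f 1 (val g x) (val h x); rewrite !scale1r.
Qed.
HB.instance Definition _ := GRing.Zmodule_isPzRing.Build lend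
  lend_mulA lend_mul1l lend_mul1r lend_mulDl lend_mulDr.

Lemma lend_scalar_subproof a : linear ( *:%R a : M -> M).
Proof. by move=> b x y; rewrite scalerDr !scalerA mulrC. Qed.
Definition lend_scalar a : lend := mk_lhom (lend_scalar_subproof a).

Lemma lend_scalar_zmod_morphism : zmod_morphism lend_scalar.
Proof. by move=> a b; apply: lhom_eq => x; rewrite /= scalerBl. Qed.
Lemma lend_scalar_monoid_morphism : monoid_morphism lend_scalar.
Proof.
by split=> [|a b]; apply: lhom_eq => x; rewrite /= ?scale1r ?scalerA.
Qed.
HB.instance Definition _ := GRing.isZmodMorphism.Build R lend lend_scalar
  lend_scalar_zmod_morphism.
HB.instance Definition _ := GRing.isMonoidMorphism.Build R lend lend_scalar
  lend_scalar_monoid_morphism.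

Lemma lend_scalarC a (f : lend) : lend_scalar a * f = f * lend_scalar a.
Proof.
by apply: lhom_eq => x; have /= := lhomP f a x 0; rewrite lhom0 !addr0.
Qed.

End EndomorphismRing.

(** * Ring maps out of a quotient *)

Section QuotientRingTheory.
Variables (R B : pzRingType) (S : R -> Prop) (h : {rmorphism R -> B}).
Hypothesis hS : forall x, S x -> h x = 0.

Lemma gen_ideal_ker x : x \in gen_ideal S -> h x = 0.
Proof.
move/gen_idealP/(_ (fun x => h x = 0)); apply=> //; split=> [|y z hy hz|a y hy].
- exact: rmorph0.
- by rewrite rmorphB hy hz subrr.
- by rewrite !rmorphM hy mulr0 mul0r.
Qed.

Lemma quot_ring_ker (x : R) : h (repr (qpi S x)) = h x.
Proof.
apply/eqP; rewrite -subr_eq0 -rmorphB; apply/eqP/gen_ideal_ker.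
by apply/qpi_eq; rewrite qpi_repr.
Qed.

End QuotientRingTheory.

(** * The functor to modules and its inverse *)

Section Equivalence.
Variables (k A : comPzRingType) (phi : {rmorphism k -> A}).
Variables (L : lieRinehart phi) (c : cocycle2 phi).
Notation D := (Lc L c).
Notation U := (Utens phi D).

Definition ugen (v : D) : U := qpi (@J1_gen _ _ phi D) (dgen phi v).
Definition ucst (l : k) : U := qpi (@J1_gen _ _ phi D) (tcst _ l).

Lemma qpiM (x y : tens (rest_lmod phi D)) :
  qpi (@J1_gen _ _ phi D) (x * y) = qpi _ x * qpi _ y :> U.
Proof. exact/esym/qmulE. Qed.

Lemma U_ind (P : U -> Prop) :
  (forall v, P (ugen v)) -> (forall l, P (ucst l)) ->
  (forall x y, P x -> P y -> P (x + y)) ->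
  (forall x y, P x -> P y -> P (x * y)) -> forall x, P x.
Proof.
move=> Pg Pc PD PM x; rewrite -[x]qpi_repr -[repr x]tpi_repr.
elim: (repr (repr x) : tterm _) => [v|l|s Ps t Pt|s Ps t Pt].
- exact: Pg.
- exact: Pc.
- by have := PD _ _ Ps Pt; rewrite -qpiD [X in qpi _ X]taddE.
- by have := PM _ _ Ps Pt; rewrite -qpiM [X in qpi _ X]tmulE.
Qed.

Lemma ugenD v w : ugen (v + w) = ugen v + ugen w.
Proof. by rewrite /ugen /dgen -qpiD -tgenD. Qed.

(** Holds since z = 1 in the quotient. Constants are thus generators too, and need no separate
    treatment in [U_linear]. *)
Lemma ucst_gen l : ucst l = ugen (phi l *: dz D).
Proof.
rewrite /ugen.
have -> : dgen phi (phi l *: dz D) = tcst _ l * dgen phi (dz D).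
  exact: (@tgenZ _ (rest_lmod phi D)).
rewrite qpiM /ucst -[LHS]mulr1; congr (_ * _).
apply/esym/qpi_eq/mem_gen_ideal; exact: J1_unit.
Qed.

Lemma ugen1 : ugen (dz D) = 1.
Proof. by apply/qpi_eq/mem_gen_ideal; exact: J1_unit. Qed.

Lemma ugenZ (a : A) (v : D) : ugen (a *: v) = ugen (a *: dz D) * ugen v.
Proof. by rewrite -qpiM; apply/qpi_eq/mem_gen_ideal; exact: J1_left. Qed.

Lemma ugen_ract (v : D) (b : A) : ugen (ract v b) = ugen v * ugen (b *: dz D).
Proof. by rewrite -qpiM; apply/qpi_eq/mem_gen_ideal; exact: J1_right. Qed.

Section ModuleOfConnection.
Variable E : conn L.

Definition psi_gen_fun (v : D) (e : rest_lmod phi E) : rest_lmod phi E :=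
  (v.1 *: (e : E) + nabla v.2 (e : E) : E).

Lemma psi_gen_subproof v : linear (psi_gen_fun v).
Proof.
move=> l x y; rewrite /psi_gen_fun.
change (v.1 *: (phi l *: (x : E) + y) + nabla v.2 (phi l *: (x : E) + y) =
  phi l *: (v.1 *: (x : E) + nabla v.2 (x : E)) + (v.1 *: (y : E) + nabla v.2 (y : E))).
by rewrite nabla_klin !scalerDr !scalerA mulrC addrACA.
Qed.

Definition psi_gen v : lend (rest_lmod phi E) := mk_lhom (psi_gen_subproof v).

Lemma psi_genD (v w : rest_lmod phi D) : psi_gen (v + w) = psi_gen v + psi_gen w.
Proof.
apply: lhom_eq => e; change ((v.1 + w.1) *: (e : E) + nabla (v.2 + w.2) (e : E) =
  (v.1 *: (e : E) + nabla v.2 (e : E)) + (w.1 *: (e : E) + nabla w.2 (e : E))).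
by rewrite scalerDl -{1}[v.2]scale1r nabla_lin scale1r addrACA.
Qed.

Lemma nabla_0l (e : E) : nabla (0 : L) e = 0.
Proof.
by apply: (addrI (nabla 0 e)); have := nabla_lin 1 (0 : L) 0 e;
  rewrite !scale1r !addr0 => <-.
Qed.

Lemma nablaZl a x (e : E) : nabla (a *: x) e = a *: nabla x e.
Proof. by have := nabla_lin a x (0 : L) e; rewrite nabla_0l !addr0. Qed.

Lemma psi_genZ (l : k) (v : rest_lmod phi D) :
  psi_gen (l *: v) = lend_scalar (rest_lmod phi E) l * psi_gen v.
Proof.
apply: lhom_eq => e; change ((phi l * v.1) *: (e : E) + nabla (phi l *: v.2) (e : E) =
  phi l *: (v.1 *: (e : E) + nabla v.2 (e : E))).
by rewrite nablaZl scalerDr scalerA.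
Qed.


Definition psi_act : {rmorphism tens (rest_lmod phi D) -> lend (rest_lmod phi E)} :=
  projT1 (cid (tens_univ (@lend_scalarC _ (rest_lmod phi E)) psi_genD psi_genZ)).

Lemma psi_act_gen v : psi_act (dgen phi v) = psi_gen v.
Proof. by rewrite /psi_act; case: cid => h [hc hg hu]; exact: hg. Qed.

Lemma psi_genM (v w : D) (e : E) :
  val (psi_gen v * psi_gen w) e =
  v.1 *: (w.1 *: e + nabla w.2 e) + nabla v.2 (w.1 *: e + nabla w.2 e).
Proof. by []. Qed.

(** The left relation is the A-linearity of [nabla] in x; the right relation is the Leibniz rule,
    whose extra term is the derivation term of the right action. *)
Lemma psi_act_J1 x : J1_gen x -> psi_act x = 0.
Proof.
have n0 := nabla_0l.
case=> [|a u|v b]; rewrite rmorphB ?rmorph1 ?rmorphM !psi_act_gen;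
  apply/eqP; rewrite subr_eq0; apply/eqP/lhom_eq => e.
- change (1 *: (e : E) + nabla (0 : L) (e : E) = e).
  by rewrite n0 scale1r addr0.
- rewrite psi_genM.
  change ((a * u.1) *: (e : E) + nabla (a *: u.2) (e : E) =
    (a * 1) *: (u.1 *: (e : E) + nabla u.2 (e : E)) +
    nabla (a *: (0 : L)) (u.1 *: (e : E) + nabla u.2 (e : E))).
  by rewrite scaler0 n0 addr0 mulr1 scalerDr scalerA nablaZl.
- rewrite psi_genM.
  change ((v.1 * b + der_ev (anchor v.2) b) *: (e : E) + nabla (b *: v.2) (e : E) =
    v.1 *: ((b * 1) *: (e : E) + nabla (b *: (0 : L)) (e : E)) +
    nabla v.2 ((b * 1) *: (e : E) + nabla (b *: (0 : L)) (e : E))).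
  rewrite scaler0 n0 addr0 mulr1 nabla_leibniz nablaZl scalerA scalerDl -addrA.
  by congr (_ + _); rewrite addrC.
Qed.

(** An alias of E that carries the U-module structure beside the A-module structure. *)
Definition psi_carrier : Type := E.
HB.instance Definition _ := GRing.Zmodule.on psi_carrier.

Definition psi_scale (u : U) (e : psi_carrier) : psi_carrier :=
  val (psi_act (repr u)) (e : E).

Lemma psi_scaleE t e : psi_scale (qpi _ t) e = val (psi_act t) (e : E).
Proof. by rewrite /psi_scale (quot_ring_ker psi_act_J1). Qed.

Lemma psi_scaleA u v e : psi_scale u (psi_scale v e) = psi_scale (u * v) e.
Proof.
by rewrite -[u]qpi_repr -[v]qpi_repr -qpiM !psi_scaleE rmorphM.
Qed.
Lemma psi_scale1 : left_id 1 psi_scale.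
Proof. by move=> e; rewrite [LHS]psi_scaleE rmorph1. Qed.
Lemma psi_scaleDr : right_distributive psi_scale +%R.
Proof.
move=> u x y; have := lhomP (psi_act (repr u)) 1 (x : rest_lmod phi E) y.
by rewrite !scale1r.
Qed.
Lemma psi_scaleDl e : {morph psi_scale^~ e : u v / u + v}.
Proof.
by move=> u v; rewrite -[u]qpi_repr -[v]qpi_repr -qpiD !psi_scaleE rmorphD.
Qed.
Definition psi_ob : lmodType U :=
  HB.pack psi_carrier (GRing.Zmodule_isLmodule.Build U psi_carrier
    psi_scaleA psi_scale1 psi_scaleDr psi_scaleDl).

Lemma psi_ugen v (e : psi_ob) :
  ugen v *: e = (v.1 *: (e : E) + nabla v.2 (e : E) : E).
Proof. by rewrite [LHS]psi_scaleE psi_act_gen. Qed.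

End ModuleOfConnection.

Lemma U_linear (M N : lmodType U) (h : M -> N) :
  {morph h : x y / x + y} ->
  (forall v x, h (ugen v *: x) = ugen v *: h x) -> linear h.
Proof.
move=> hD hg; have hZ u x : h (u *: x) = u *: h x.
  elim/U_ind: u x => [v|l|u v hu hv|u v hu hv] x //.
  - by rewrite ucst_gen.
  - by rewrite !scalerDl hD hu hv.
  - by rewrite -!scalerA hu hv.
by move=> u x y; rewrite hD hZ.
Qed.

Lemma linear_morphD (R : pzRingType) (M N : lmodType R) (h : M -> N) :
  linear h -> {morph h : x y / x + y}.
Proof. by move=> lh x y; have := lh 1 x y; rewrite !scale1r. Qed.

Lemma linear_morphZ (R : pzRingType) (M N : lmodType R) (h : M -> N) :
  linear h -> forall a x, h (a *: x) = a *: h x.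
Proof.
move=> lh a x; have h0 : h 0 = 0 := lhom0 (mk_lhom lh).
by have := lh a x 0; rewrite h0 !addr0.
Qed.

Lemma psi_hom_subproof (E F : conn L) (h : chom E F) :
  linear (val h : psi_ob E -> psi_ob F).
Proof.
have [hl hn] := chomP h; have hD := linear_morphD hl.
apply: U_linear => // v e.
by rewrite !psi_ugen hD (linear_morphZ hl) hn.
Qed.

Definition psi : functor (Conn L) (Mod U).
Proof.
unshelve refine (@Functor (Conn L) (Mod U) psi_ob
  (fun E F h => mk_lhom (psi_hom_subproof h)) _ _).
- by move=> E; apply: lhom_eq.
- by move=> E F G g f; apply: lhom_eq.
Defined.

Section ConnectionOfModule.
Variable M : lmodType U.

Definition gam_carrier : Type := M.
HB.instance Definition _ := GRing.Zmodule.on gam_carrier.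

Definition inA (a : A) : D := (a, 0 : L).
Definition inL (x : L) : D := (0 : A, x).

Lemma inAE a : inA a = a *: dz D.
Proof. by congr pair; rewrite ?scaler0 // -[LHS]mulr1. Qed.

Lemma inAD a b : inA (a + b) = inA a + inA b.
Proof. by congr pair; rewrite addr0. Qed.

Lemma inLD x y : inL (x + y) = inL x + inL y.
Proof. by congr pair; rewrite addr0. Qed.

Lemma inLZ a x : inL (a *: x) = a *: inL x.
Proof. by congr pair; rewrite scaler0. Qed.

Lemma inAL (v : D) : v = inA v.1 + inL v.2.
Proof. by case: v => a x; congr pair; rewrite /= ?addr0 ?add0r. Qed.

Lemma ugenAZ a (v : D) : ugen (a *: v) = ugen (inA a) * ugen v.
Proof. by rewrite ugenZ inAE. Qed.

Definition gam_scale (a : A) (m : gam_carrier) : gam_carrier :=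
  ugen (inA a) *: (m : M).

Lemma gam_scaleA a b m : gam_scale a (gam_scale b m) = gam_scale (a * b) m.
Proof. by rewrite /gam_scale scalerA -ugenAZ !inAE scalerA. Qed.
Lemma gam_scale1 : left_id 1 gam_scale.
Proof. by move=> m; rewrite /gam_scale inAE scale1r ugen1 scale1r. Qed.
Lemma gam_scaleDr : right_distributive gam_scale +%R.
Proof. by move=> a x y; rewrite /gam_scale scalerDr. Qed.
Lemma gam_scaleDl m : {morph gam_scale^~ m : a b / a + b}.
Proof. by move=> a b; rewrite /gam_scale inAD ugenD scalerDl. Qed.
Definition gam_mod : lmodType A :=
  HB.pack gam_carrier (GRing.Zmodule_isLmodule.Build A gam_carrier
    gam_scaleA gam_scale1 gam_scaleDr gam_scaleDl).

Definition gam_nabla (x : L) (m : gam_mod) : gam_mod := ugen (inL x) *: (m : M).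

(** By the right relation, x times uz is the right action of u on x, which is ux + x(u)z. *)
Lemma gam_leibniz x (u : A) (m : gam_mod) :
  gam_nabla x (u *: m) = u *: gam_nabla x m + der_ev (anchor x) u *: m.
Proof.
change (ugen (inL x) *: (ugen (inA u) *: (m : M)) =
  ugen (inA u) *: (ugen (inL x) *: (m : M)) + ugen (inA (der_ev (anchor x) u)) *: (m : M)).
rewrite !scalerA -scalerDl -ugenAZ -ugenD; congr (_ *: _).
rewrite [inA u]inAE -ugen_ract; congr (ugen _).
by congr pair; rewrite /= ?mul0r ?scaler0 ?addr0 // add0r.
Qed.

Lemma gam_klin x (l : k) (m m' : gam_mod) :
  gam_nabla x (phi l *: m + m') = phi l *: gam_nabla x m + gam_nabla x m'.
Proof.
(* Derivations kill the image of k, since d(1) = d(1) + d(1); the Leibniz rule then gives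
   k-linearity. *)
have der0 : der_ev (anchor x) (phi l) = 0.
  have [dl dM] := derP (anchor x).
  have d0 : der_ev (anchor x) 0 = 0.
    by have := dM 0 0; rewrite !mulr0 mul0r addr0.
  have d1 : der_ev (anchor x) 1 = 0.
    have := dM 1 1; rewrite !mulr1 mul1r => /eqP.
    by rewrite -subr_eq0 opprD addrA subrr sub0r oppr_eq0 => /eqP.
  by have := dl l 1 0; rewrite mulr1 addr0 d1 d0 mulr0 addr0.
transitivity (gam_nabla x (phi l *: m) + gam_nabla x m').
  exact: (scalerDr (ugen (inL x)) (phi l *: m : M) (m' : M)).
rewrite gam_leibniz der0; congr (_ + _).
by rewrite scale0r addr0.
Qed.

Lemma gam_lin (u : A) x x' (m : gam_mod) :
  gam_nabla (u *: x + x') m = u *: gam_nabla x m + gam_nabla x' m.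
Proof.
change (ugen (inL (u *: x + x')) *: (m : M) =
  ugen (inA u) *: (ugen (inL x) *: (m : M)) + ugen (inL x') *: (m : M)).
by rewrite scalerA -ugenAZ -scalerDl -ugenD inLD inLZ.
Qed.

Definition gam_ob : conn L := Connection gam_klin gam_lin gam_leibniz.

End ConnectionOfModule.

Lemma gam_hom_subproof (M N : lmodType U) (h : lhom M N) :
  @is_chom _ _ _ L (gam_ob M) (gam_ob N) (val h).
Proof.
have hZ := linear_morphZ (lhomP h).
split=> [a x y|x m]; last exact: hZ.
rewrite (linear_morphD (lhomP h)); congr (_ + _); exact: hZ.
Qed.

Definition gam : functor (Mod U) (Conn L).
Proof.
unshelve refine (@Functor (Mod U) (Conn L) gam_ob
  (fun M N h => mk_chom (gam_hom_subproof h)) _ _).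
- by move=> M; apply: chom_eq.
- by move=> M N P g f; apply: chom_eq.
Defined.

Lemma gam_psi_scale (E : conn L) (a : A) (e : E) :
  (a *: (e : gam_ob (psi_ob E)) : gam_ob (psi_ob E)) = (a *: e : E).
Proof.
by rewrite [LHS](psi_ugen (inA a) e) /= nabla_0l addr0.
Qed.

Lemma gam_psi_nabla (E : conn L) (x : L) (e : E) :
  (nabla x (e : gam_ob (psi_ob E)) : gam_ob (psi_ob E)) = (nabla x e : E).
Proof.
by rewrite [LHS](psi_ugen (inL x) e) /= scale0r add0r.
Qed.

Lemma psi_gam_scale (M : lmodType U) (v : D) (m : M) :
  (ugen v *: (m : psi_ob (gam_ob M)) : psi_ob (gam_ob M)) = (ugen v *: m : M).
Proof.
rewrite psi_ugen; change (ugen (inA v.1) *: m + ugen (inL v.2) *: m = ugen v *: m).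
by rewrite -scalerDl -ugenD -inAL.
Qed.

(** Both composites keep the underlying group, and the isomorphisms are identity maps; only the
    agreement of the two actions has to be checked. *)
Lemma psi_equivalence : is_equivalence psi.
Proof.
exists gam; split.
- unshelve eexists.
    move=> E; apply: (@mk_chom _ _ _ L (gam_ob (psi_ob E)) E id).
    split=> [a x y|x e]; last exact: gam_psi_nabla.
    by congr (_ + _); exact: gam_psi_scale.
  unshelve eexists.
    move=> E; apply: (@mk_chom _ _ _ L E (gam_ob (psi_ob E)) id).
    split=> [a x y|x e]; last exact/esym/gam_psi_nabla.
    by congr (_ + _); exact/esym/gam_psi_scale.
  by split=> *; apply: chom_eq.
- unshelve eexists.
    move=> M; apply: (@mk_lhom _ (psi_ob (gam_ob M)) M id).
    by apply: U_linear => // v x; exact: psi_gam_scale.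
  unshelve eexists.
    move=> M; apply: (@mk_lhom _ M (psi_ob (gam_ob M)) id).
    by apply: U_linear => // v x; exact/esym/psi_gam_scale.
  by split=> *; apply: lhom_eq.
Qed.

Lemma psi_additive (E F : Conn L) (f g : hom E F) :
  fmap psi (f + g) = fmap psi f + fmap psi g.
Proof. exact: lhom_eq. Qed.

End Equivalence.

Theorem mainTheorem4 (k A : comPzRingType) (phi : {rmorphism k -> A})
    (L : lieRinehart phi) (c : cocycle2 phi) :
  exists psi : functor (Conn L) (Mod (Utens phi (Lc L c))),
    is_equivalence psi /\
    is_exact psi /\
    (forall E : Conn L, injective_ob E -> injective_ob (psi E)) /\
    (forall E : Conn L, projective E -> projective (psi E)) /\
    (forall (V W : Conn L) (i : nat), yext_iso i V W (Ext i (psi V) (psi W))).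
Proof.
have eF := psi_equivalence L c.
have aF : is_additive (psi L c) by move=> X Y f g; exact: psi_additive.
exists (psi L c); split=> //; split; first exact: equivalence_exact.
split; first by move=> E; exact: fmap_injective.
split; first by move=> E; exact: fmap_projective.
by move=> V W i; apply: yext_iso_homology => //; exact: Mod_abelian.
Qed.
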